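(* Let the initial-boundary value problem $$\frac{\partial^2 u}{\partial t^2}(x,t)-\Big(\alpha(t)+\beta(t)\int_0^\ell\Big[\frac{\partial u}{\partial x}(x,t)\Big]^2dx\Big)\frac{\partial^2u}{\partial x^2}(x,t)=f(x,t),\quad (x,t)\in(0,\ell)\times(0,T],$$ $$u(x,0)=\psi_0(x),\quad u_t(x,0)=\psi_1(x),\quad u(0,t)=u(\ell,t)=0,$$ be well-posed, with solution $u(x,t)$, and suppose that: (a) $\psi_0\in C^2([0,\ell])$ with $\psi_0(0)=\psi_0(\ell)=0$, $\psi_1\in C^1([0,\ell])$, and the function $u_x(x,t)$ has a continuous second-order derivative with respect to $t$; (b) $u(x,t)$ is continuously differentiable up to and including the third order with respect to $t$, and $u_{ttt}(x,t)$ is Lipschitz continuous with respect to $t$ (with a constant independent of $x$); (c) $u_{xx}(x,t)$ is continuously differentiable with respect to $t$, and $u_{xxt}(x,t)$ is Lipschitz continuous with respect to $t$ (with a constant independent of $x$). Then there exist $\overline T$ with $0<\overline T\le T$ and positive constants $M_5,M_6$, all independent of $\tau$, such that the errors $z_k(x)=u(x,t_k)-u_k(x)$ of the approximate solutions $u_k$ produced by the three-layer semi-discrete scheme with time step $\tau=T/n$ (defined in the context) satisfy $$\max_{1\le k\le m}\Big\|\frac{dz_k}{dx}\Big\|\le M_5\tau^2,\qquad \max_{0\le k\le m-1}\Big\|\frac{z_{k+1}-z_k}{\tau}\Big\|\le M_6\tau^2,\qquad m=\Big[\frac{\overline T}{\tau}\Big].$$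
   Context: Standing assumptions: $\ell,T>0$; $\alpha,\beta$ are continuously differentiable on $[0,T]$ with $\alpha(t)\ge c_0>0$ and $\beta(t)\ge c_1>0$ for constants $c_0,c_1$; $f$ is continuous on $[0,\ell]\times[0,T]$; $\psi_0,\psi_1$ are continuous and $\psi_0(0)=\psi_0(\ell)=0$. Continuity and differentiability of $u$ and its derivatives are understood on $[0,\ell]\times[0,T]$. $\|\cdot\|$ is the norm of $L_2(0,\ell)$ and $[\cdot]$ is the integer part (maxima over empty index sets impose no condition). Scheme: for a positive integer $n$ put $\tau=T/n$, $t_k=k\tau$ ($k=0,\dots,n$), $f_k(x)=f(x,t_k)$, $\alpha_k=\alpha(t_k)$, $\beta_k=\beta(t_k)$. The approximate solutions $u_k(x)\approx u(x,t_k)$ are defined by $$u_0=\psi_0,\qquad u_1=\psi_0+\tau\psi_1+\frac{\tau^2}{2}\psi_2,\qquad \psi_2=f_0+q_0\,\psi_0'',$$ and, for $k=1,2,\dots,n-1$, $$\frac{u_{k+1}-2u_k+u_{k-1}}{\tau^2}-\frac12\,q_k\left(\frac{d^2u_{k+1}}{dx^2}+\frac{d^2u_{k-1}}{dx^2}\right)=f_k,\qquad u_{k+1}(0)=u_{k+1}(\ell)=0,$$ where $$q_k=\alpha_k+\beta_k\int_0^\ell\Big(\frac{du_k}{dx}\Big)^2dx\qquad(k\ge0).$$ The sum of the two second derivatives is understood as $\frac{d^2}{dx^2}(u_{k+1}+u_{k-1})$, so that $u_{k+1}=\mathcal A_k^{-1}(\tau^2f_k+2u_k)-u_{k-1}$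 where $\mathcal A_k=I-\frac12\tau^2q_k\frac{d^2}{dx^2}$ with homogeneous Dirichlet boundary conditions at $0$ and $\ell$. *)

(* Defs.v *)
From Stdlib Require Import Reals.
From Coquelicot Require Import Coquelicot.
Open Scope R_scope.

Definition itv (a x : R) : Prop := 0 <= x <= a.

Definition rect (l T : R) (p : R * R) : Prop := itv l (fst p) /\ itv T (snd p).

Definition cont2_on (l T : R) (g : R -> R -> R) : Prop :=
  continuous_on (rect l T) (fun p : R * R => g (fst p) (snd p)).

(* Derivatives on closed intervals are taken relative to the interval, hence
   one-sided at the endpoints; the values of g outside [0, a] play no role. *)
Definition deriv_on (a : R) (g g' : R -> R) : Prop :=
  forall x, itv a x -> D_in g g' (itv a) x.

Definition C1_on (a : R) (g : R -> R) : Prop :=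
  exists g', deriv_on a g g' /\ continuous_on (itv a) g'.

Definition dx_on (l T : R) (g gx : R -> R -> R) : Prop :=
  forall t, itv T t -> deriv_on l (fun x => g x t) (fun x => gx x t).

Definition dt_on (l T : R) (g gt : R -> R -> R) : Prop :=
  forall x, itv l x -> deriv_on T (g x) (gt x).

Definition lipschitz_t (l T : R) (g : R -> R -> R) : Prop :=
  exists L, forall x t s, itv l x -> itv T t -> itv T s ->
    Rabs (g x t - g x s) <= L * Rabs (t - s).

(* It is applied only to continuous functions, or to derivatives continuous on
   (0, l) up to the endpoints; for these the Riemann integral is the Lebesgue
   integral. Values at 0 and l are irrelevant. *)
Definition L2norm (l : R) (g : R -> R) : R :=
  sqrt (RInt (fun x => g x ^ 2) 0 l).

Record classical_solution (l T : R) (alpha beta : R -> R) (f : R -> R -> R)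
    (psi0 psi1 : R -> R) (u ux uxx ut utt : R -> R -> R) : Prop := {
  sol_ux : dx_on l T u ux;
  sol_uxx : dx_on l T ux uxx;
  sol_ut : dt_on l T u ut;
  sol_utt : dt_on l T ut utt;
  sol_u_cont : cont2_on l T u;
  sol_ux_cont : cont2_on l T ux;
  sol_uxx_cont : cont2_on l T uxx;
  sol_ut_cont : cont2_on l T ut;
  sol_utt_cont : cont2_on l T utt;
  sol_eq : forall x t, 0 < x < l -> 0 < t <= T ->
    utt x t - (alpha t + beta t * RInt (fun y => ux y t ^ 2) 0 l) * uxx x t
      = f x t;
  sol_init0 : forall x, itv l x -> u x 0 = psi0 x;
  sol_init1 : forall x, itv l x -> ut x 0 = psi1 x;
  sol_bc : forall t, itv T t -> u 0 t = 0 /\ u l t = 0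
}.

(* The problem has one and only one classical solution, namely u. Stability
   with respect to the data, the remaining part of well-posedness in the sense
   of Hadamard, is not demanded. *)
Definition well_posed_with_solution (l T : R) (alpha beta : R -> R)
    (f : R -> R -> R) (psi0 psi1 : R -> R) (u ux uxx ut utt : R -> R -> R)
    : Prop :=
  classical_solution l T alpha beta f psi0 psi1 u ux uxx ut utt /\
  (forall v vx vxx vt vtt,
     classical_solution l T alpha beta f psi0 psi1 v vx vxx vt vtt ->
     forall x t, itv l x -> itv T t -> v x t = u x t).

Definition step (T : R) (n : nat) : R := T / INR n.

Definition node (T : R) (n k : nat) : R := INR k * step T n.

Definition qcoef (l T : R) (alpha beta : R -> R) (n : nat) (U : nat -> R -> R)
    (k : nat) : R :=
  alpha (node T n k)
  + beta (node T n k) * RInt (fun x => Derive (U k) x ^ 2) 0 l.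

(* The second derivative is that of the sum U (k+1) + U (k-1): in general the
   two functions are not separately twice differentiable, since U 1 is not.
   ddpsi0 stands for the second derivative of psi0. *)
Record scheme (l T : R) (alpha beta : R -> R) (f : R -> R -> R)
    (psi0 ddpsi0 psi1 : R -> R) (n : nat) (U : nat -> R -> R) : Prop := {
  scheme_0 : forall x, itv l x -> U 0%nat x = psi0 x;
  scheme_1 : forall x, itv l x ->
    U 1%nat x = psi0 x + step T n * psi1 x
      + step T n ^ 2 / 2
        * (f x 0 + qcoef l T alpha beta n U 0 * ddpsi0 x);
  scheme_bc : forall k, (1 <= k <= n - 1)%nat ->
    U (k + 1)%nat 0 = 0 /\ U (k + 1)%nat l = 0;
  scheme_step : forall k, (1 <= k <= n - 1)%nat ->
    exists w' w'' : R -> R,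
      deriv_on l (fun x => U (k + 1)%nat x + U (k - 1)%nat x) w' /\
      deriv_on l w' w'' /\
      forall x, itv l x ->
        (U (k + 1)%nat x - 2 * U k x + U (k - 1)%nat x) / step T n ^ 2
          - 1 / 2 * qcoef l T alpha beta n U k * w'' x
        = f x (node T n k)
}.

(* Main.v *)
(* Taylor expansion shows that the exact solution satisfies the scheme up to a
   residual O(tau^2); at the first step one also needs that u_t and u_tt are
   differentiable in x at t = 0 with derivatives u_xt and u_xtt. Testing the
   error equation with z_(k+1) - z_(k-1) gives an energy inequality for
   E_k = |(z_(k+1) - z_k)/tau|^2 + q_k (|z_(k+1)'|^2 + |z_k'|^2) / 2, in which
   the nonlinearity enters through q(t_k) - q_k = O(|z_k'|) and
   q_k - q_(k-1) = O(tau); the latter holds as long as |z_k'|, |z_(k-1)'| <= tau.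
   Discrete Gronwall then yields E_k = O(tau^4), which for small tau reproduces
   that smallness assumption. Large tau are excluded by the choice of Tbar:
   if tau > Tbar then m = 0 and both maxima are empty.

   Functions on [0, a] are composed with the retraction clamp a of the line onto
   [0, a]; this turns relative continuity into continuity on the whole line. *)
Require Import Defs.
From Stdlib Require Import Reals Lra Lia Psatz.
From Coquelicot Require Import Coquelicot.
Open Scope R_scope.

(** With the test function z_(k+1) - z_(k-1) both terms of the error equation telescope, and only
    the second derivative of z_(k+1) + z_(k-1) is called for, the one that the scheme supplies. This
    matters because U 1 contains psi2 = f_0 + q_0 psi0'', for which the data give continuity and
    nothing more. That U 1 has even one derivative is read off the exact solution, since psi2 =
    u_tt(., 0). Hypothesis (a), however, speaks of time derivatives of u_x, so x- and t-derivatives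
    have to be exchanged at t = 0. The bootstrap is not circular: the Gronwall constant [M] is
    computed over all of [0, T] before the step is restricted, and the threshold [tau0] depends on
    [M], not conversely. For tau <= [tau0] the estimates hold at every node of [0, T]; thus [Tbar]
    expresses a bound on the step and not a time of existence. *)

(** * Continuity on the whole line *)

Definition cts (f : R -> R) : Prop := forall x, continuous f x.

Lemma cts_const c : cts (fun _ => c).
Proof. intros x; apply continuous_const. Qed.

Lemma cts_plus f g : cts f -> cts g -> cts (fun x => f x + g x).
Proof. intros hf hg x; apply (continuous_plus f g); auto. Qed.

Lemma cts_mult f g : cts f -> cts g -> cts (fun x => f x * g x).
Proof. intros hf hg x; apply (continuous_mult f g); auto. Qed.

Lemma cts_opp f : cts f -> cts (fun x => - f x).
Proof. intros hf x; apply (continuous_opp f); auto. Qed.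

Lemma cts_minus f g : cts f -> cts g -> cts (fun x => f x - g x).
Proof. intros hf hg; apply cts_plus; [|apply cts_opp]; auto. Qed.

Lemma cts_pow f n : cts f -> cts (fun x => f x ^ n).
Proof.
  intros hf; induction n as [|n IH]; [apply (cts_const 1)|].
  apply (cts_mult f (fun x => f x ^ n)); auto.
Qed.

Lemma cts_div f c : cts f -> cts (fun x => f x / c).
Proof. intros hf; apply cts_mult; [|apply cts_const]; auto. Qed.

Lemma cts_affine a b : cts (fun x => a + b * x).
Proof.
  apply cts_plus; [apply cts_const|apply cts_mult; [apply cts_const|]].
  intros x; apply continuous_id.
Qed.

Lemma cts_comp f g : cts f -> cts g -> cts (fun x => g (f x)).
Proof. intros hf hg x; apply (continuous_comp f g); auto. Qed.

Ltac cts_tac :=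
  cbv beta;
  repeat match goal with
  | h : cts ?f |- cts ?f => exact h
  | h : cts ?f |- cts (fun x => ?f x) => exact h
  | |- cts (fun _ => ?c) => apply (cts_const c)
  | |- cts (fun x => @?f x + @?g x) => apply (cts_plus f g)
  | |- cts (fun x => @?f x - @?g x) => apply (cts_minus f g)
  | |- cts (fun x => @?f x / ?c) => apply (cts_div f c)
  | |- cts (fun x => @?f x * @?g x) => apply (cts_mult f g)
  | |- cts (fun x => @?f x ^ ?n) => apply (cts_pow f n)
  end.

Lemma cts_eps f x : cts f -> forall eps, 0 < eps ->
  exists d, 0 < d /\ forall y, Rabs (y - x) < d -> Rabs (f y - f x) < eps.
Proof.
  intros hf eps he.
  destruct (proj1 (filterlim_locally f (f x)) (hf x) (mkposreal eps he))
    as [d hd].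
  exists d; split; [apply cond_pos|intros y hy; apply (hd y hy)].
Qed.

Lemma eps_cts f :
  (forall x eps, 0 < eps ->
    exists d, 0 < d /\ forall y, Rabs (y - x) < d -> Rabs (f y - f x) < eps) ->
  cts f.
Proof.
  intros h x; apply filterlim_locally; intros eps.
  destruct (h x eps (cond_pos eps)) as [d [hd H]].
  exists (mkposreal d hd); intros y hy; apply H, hy.
Qed.

Lemma cts_ex_RInt f a b : cts f -> ex_RInt f a b.
Proof.
  intros hf; apply (ex_RInt_continuous (V := R_CompleteNormedModule)); auto.
Qed.

(** Serves for [uxt] at time 0, whose continuity in x is obtained by writing it as a uniform limit
    of difference quotients of [ux]. *)
Lemma uniform_limit_cts f :
  (forall eps, 0 < eps -> exists g, cts g /\ forall x, Rabs (g x - f x) <= eps) ->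
  cts f.
Proof.
  intros h; apply eps_cts; intros x eps he.
  destruct (h (eps / 4)) as [g [hg hgf]]; [lra|].
  destruct (cts_eps g x hg (eps / 4)) as [d [hd H]]; [lra|].
  exists d; split; auto; intros y hy.
  specialize (H y hy); pose proof (hgf x) as h1; pose proof (hgf y) as h2.
  revert H h1 h2; unfold Rabs; repeat destruct Rcase_abs; lra.
Qed.

(** * Clamped extensions *)

Definition clamp (a x : R) : R := Rmax 0 (Rmin x a).

Lemma clamp_itv a x : 0 <= a -> itv a (clamp a x).
Proof.
  intros ha; unfold itv, clamp, Rmax, Rmin; repeat destruct Rle_dec; lra.
Qed.

Lemma clamp_id a x : itv a x -> clamp a x = x.
Proof.
  unfold itv, clamp, Rmax, Rmin; intros hx; repeat destruct Rle_dec; lra.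
Qed.

Lemma clamp_lip a x y : Rabs (clamp a x - clamp a y) <= Rabs (x - y).
Proof.
  unfold clamp, Rmax, Rmin, Rabs; repeat destruct Rle_dec;
  repeat destruct Rcase_abs; lra.
Qed.

Lemma clamp_locally a x : 0 < x < a -> locally x (fun y => clamp a y = y).
Proof.
  intros hx.
  assert (hd : 0 < Rmin x (a - x)) by (apply Rmin_glb_lt; lra).
  exists (mkposreal _ hd); intros y hy; apply clamp_id; unfold itv.
  change (Rabs (y - x) < Rmin x (a - x)) in hy.
  pose proof (Rmin_l x (a - x)); pose proof (Rmin_r x (a - x)).
  apply Rabs_def2 in hy; lra.
Qed.

Lemma continuous_on_clamp a g :
  0 <= a -> continuous_on (itv a) g -> cts (fun x => g (clamp a x)).
Proof.
  intros ha hg; apply eps_cts; intros x eps he.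
  pose proof (hg (clamp a x) (clamp_itv a x ha)) as h.
  destruct (proj1 (filterlim_locally g _) h (mkposreal eps he)) as [d hd].
  exists d; split; [apply cond_pos|]; intros y hy.
  apply hd; [|apply clamp_itv; auto].
  change (Rabs (clamp a y - clamp a x) < d).
  pose proof (clamp_lip a y x); lra.
Qed.

Definition clamp2 (l T : R) (g : R -> R -> R) (x t : R) : R :=
  g (clamp l x) (clamp T t).

Lemma cont2_on_clamp l T g : 0 <= l -> 0 <= T -> cont2_on l T g ->
  forall x t, continuity_2d_pt (clamp2 l T g) x t.
Proof.
  intros hl hT hg x t eps.
  pose proof (hg (clamp l x, clamp T t)
    (conj (clamp_itv l x hl) (clamp_itv T t hT))) as h.
  destruct (proj1 (filterlim_locally _ _) h eps) as [d hd].
  exists d; intros x' t' hx ht.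
  apply (hd (clamp l x', clamp T t')).
  - split; simpl.
    + change (Rabs (clamp l x' - clamp l x) < d).
      pose proof (clamp_lip l x' x); lra.
    + change (Rabs (clamp T t' - clamp T t) < d).
      pose proof (clamp_lip T t' t); lra.
  - split; simpl; apply clamp_itv; auto.
Qed.

Lemma continuity_2d_cts_l g t :
  (forall x t, continuity_2d_pt g x t) -> cts (fun x => g x t).
Proof.
  intros hg; apply eps_cts; intros x eps he.
  destruct (hg x t (mkposreal eps he)) as [d hd].
  exists d; split; [apply cond_pos|]; intros y hy; apply hd; auto.
  rewrite Rminus_diag, Rabs_R0; apply cond_pos.
Qed.

Lemma continuity_2d_cts_r g x :
  (forall x t, continuity_2d_pt g x t) -> cts (g x).
Proof.
  intros hg; apply eps_cts; intros t eps he.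
  destruct (hg x t (mkposreal eps he)) as [d hd].
  exists d; split; [apply cond_pos|]; intros y hy; apply hd; auto.
  rewrite Rminus_diag, Rabs_R0; apply cond_pos.
Qed.

Lemma cont2_on_cts_x l T g t : 0 <= l -> 0 <= T -> cont2_on l T g -> itv T t ->
  cts (fun x => g (clamp l x) t).
Proof.
  intros hl hT hg ht.
  pose proof (continuity_2d_cts_l _ t (cont2_on_clamp l T g hl hT hg)) as h.
  unfold clamp2 in h; rewrite (clamp_id T t ht) in h; exact h.
Qed.

Lemma cont2_on_cts_t l T g x : 0 <= l -> 0 <= T -> cont2_on l T g -> itv l x ->
  cts (fun t => g x (clamp T t)).
Proof.
  intros hl hT hg hx.
  pose proof (continuity_2d_cts_r _ x (cont2_on_clamp l T g hl hT hg)) as h.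
  unfold clamp2 in h; rewrite (clamp_id l x hx) in h; exact h.
Qed.

(* Walking from the origin to (x, t) in N steps shorter than a modulus of
   uniform continuity for 1. *)
Lemma cont2_on_bounded l T g : 0 <= l -> 0 <= T -> cont2_on l T g ->
  exists B, 0 < B /\ forall x t, itv l x -> itv T t -> Rabs (g x t) <= B.
Proof.
  intros hl hT hg.
  pose proof (cont2_on_clamp l T g hl hT hg) as hc.
  destruct (uniform_continuity_2d (clamp2 l T g) 0 l 0 T
    (fun x y _ _ => hc x y) (mkposreal 1 Rlt_0_1)) as [d hd].
  destruct (INR_unbounded ((l + T) / d)) as [N hN].
  assert (hd0 := cond_pos d).
  assert (hN0 : 0 < INR N).
  { apply Rle_lt_trans with (2 := hN). apply Rdiv_le_0_compat; lra. }
  assert (hlT : l + T < INR N * d).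
  { apply (Rmult_lt_compat_r d) in hN; auto.
    replace ((l + T) / d * d) with (l + T) in hN by (field; lra); auto. }
  exists (Rabs (clamp2 l T g 0 0) + INR N + 1); split.
  { pose proof (Rabs_pos (clamp2 l T g 0 0)); lra. }
  intros x t hx ht.
  assert (H : forall k, (k <= N)%nat ->
    Rabs (clamp2 l T g (INR k * (x / INR N)) (INR k * (t / INR N)))
      <= Rabs (clamp2 l T g 0 0) + INR k).
  { assert (step_small : forall a b, itv b a -> b <= l + T ->
      0 <= a / INR N < d /\ INR N * (a / INR N) = a).
    { intros a b ha hb; destruct ha as [ha1 ha2]; split; [split|].
      - apply Rdiv_le_0_compat; lra.
      - apply Rmult_lt_reg_l with (INR N); auto.
        replace (INR N * (a / INR N)) with a by (field; lra); lra.
      - field; lra. }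
    destruct (step_small x l hx) as [hx1 hx2]; [lra|].
    destruct (step_small t T ht) as [ht1 ht2]; [lra|].
    induction k as [|k IH]; intros hk.
    - simpl; rewrite !Rmult_0_l; lra.
    - specialize (IH ltac:(lia)).
      assert (hk' : INR k + 1 <= INR N) by (rewrite <- S_INR; apply le_INR; lia).
      pose proof (pos_INR k) as hk0.
      unfold itv in hx, ht.
      rewrite S_INR.
      assert (Hstep := hd (INR k * (x / INR N)) (INR k * (t / INR N))
        ((INR k + 1) * (x / INR N)) ((INR k + 1) * (t / INR N))).
      simpl in Hstep.
      assert (Rabs (clamp2 l T g ((INR k + 1) * (x / INR N))
          ((INR k + 1) * (t / INR N))
        - clamp2 l T g (INR k * (x / INR N)) (INR k * (t / INR N))) < 1).
      { apply Hstep; try nra.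
        - replace ((INR k + 1) * (x / INR N) - INR k * (x / INR N))
            with (x / INR N) by ring; rewrite Rabs_pos_eq; lra.
        - replace ((INR k + 1) * (t / INR N) - INR k * (t / INR N))
            with (t / INR N) by ring; rewrite Rabs_pos_eq; lra. }
      pose proof (Rabs_triang_inv (clamp2 l T g ((INR k + 1) * (x / INR N))
          ((INR k + 1) * (t / INR N)))
        (clamp2 l T g (INR k * (x / INR N)) (INR k * (t / INR N)))).
      lra. }
  specialize (H N (le_n N)).
  replace (INR N * (x / INR N)) with x in H by (field; lra).
  replace (INR N * (t / INR N)) with t in H by (field; lra).
  unfold clamp2 in H at 1; rewrite !clamp_id in H by auto; lra.
Qed.

Lemma continuous_on_bounded a g : 0 <= a -> continuous_on (itv a) g ->
  exists B, 0 < B /\ forall x, itv a x -> Rabs (g x) <= B.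
Proof.
  intros ha hg.
  (* The interval is treated as the degenerate rectangle [0, a] x {0}. *)
  destruct (cont2_on_bounded a 0 (fun x _ => g x) ha (Rle_refl 0)) as [B [hB H]].
  - intros [x t] [hx _]; simpl in *.
    intros P hP; destruct (hg x hx P hP) as [d hd].
    exists d; intros [x' t'] [h1 _] [h2 _]; apply hd; auto.
  - exists B; split; auto; intros x hx; apply (H x 0); auto; unfold itv; lra.
Qed.

(** * Antiderivatives on an open interval *)

(** The derivative is demanded on the open interval only, because a clamped extension may have
    corners at the endpoints. Continuity of F is what the mean value theorem needs in addition. *)
Definition antideriv (a b : R) (F f : R -> R) : Prop :=
  cts F /\ forall x, a < x < b -> is_derive F x (f x).

Lemma antideriv_ext a b F f g :
  antideriv a b F f -> (forall x, a < x < b -> f x = g x) -> antideriv a b F g.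
Proof.
  intros [h1 h2] h; split; auto; intros x hx; rewrite <- h; auto.
Qed.

Lemma antideriv_sub a b a' b' F f :
  antideriv a b F f -> a <= a' -> b' <= b -> antideriv a' b' F f.
Proof. intros [h1 h2] ha hb; split; auto; intros x hx; apply h2; lra. Qed.

Lemma antideriv_plus a b F f G g : antideriv a b F f -> antideriv a b G g ->
  antideriv a b (fun x => F x + G x) (fun x => f x + g x).
Proof.
  intros [h1 h2] [h3 h4]; split; [cts_tac|]; intros x hx.
  apply (is_derive_plus F G x (f x) (g x)); auto.
Qed.

Lemma antideriv_scal a b c F f : antideriv a b F f ->
  antideriv a b (fun x => c * F x) (fun x => c * f x).
Proof.
  intros [h1 h2]; split; [cts_tac|]; intros x hx.
  apply (is_derive_scal F x c (f x)); auto.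
Qed.

Lemma antideriv_minus a b F f G g : antideriv a b F f -> antideriv a b G g ->
  antideriv a b (fun x => F x - G x) (fun x => f x - g x).
Proof.
  intros [h1 h2] [h3 h4]; split; [cts_tac|]; intros x hx.
  apply (is_derive_minus F G x (f x) (g x)); auto.
Qed.

Lemma antideriv_mult a b F f G g : antideriv a b F f -> antideriv a b G g ->
  antideriv a b (fun x => F x * G x) (fun x => f x * G x + F x * g x).
Proof.
  intros [h1 h2] [h3 h4]; split; [cts_tac|]; intros x hx.
  apply (is_derive_mult F G x (f x) (g x)); auto.
  intros; apply Rmult_comm.
Qed.

(** Both signs are wanted in order to form F(t + s) + F(t - s) and F(t + s) - F(t - s). The
    reflection reverses the interval, hence [Rmin] and [Rmax]. *)
Lemma antideriv_shift a b c s F f : s = 1 \/ s = -1 ->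
  antideriv (Rmin (c + s * a) (c + s * b)) (Rmax (c + s * a) (c + s * b)) F f ->
  antideriv a b (fun x => F (c + s * x)) (fun x => s * f (c + s * x)).
Proof.
  intros hs [h1 h2]; split.
  - apply (cts_comp (fun x => c + s * x) F); [apply cts_affine|auto].
  - intros x hx.
    apply (is_derive_comp F (fun x => c + s * x) x).
    + apply h2.
      unfold Rmin, Rmax; repeat destruct Rle_dec; destruct hs; subst; lra.
    + auto_derive; auto; ring.
Qed.

Lemma antideriv_id a b : antideriv a b (fun x => x) (fun _ => 1).
Proof.
  split; [intros x; apply continuous_id|intros x _; apply (is_derive_id x)].
Qed.

Lemma antideriv_RInt a b c f : cts f -> antideriv a b (fun x => RInt f c x) f.
Proof.
  intros hf.
  assert (h : forall x, is_derive (fun x => RInt f c x) x (f x)).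
  { intros x; apply (is_derive_RInt f (fun x => RInt f c x) c x); auto.
    exists (mkposreal 1 Rlt_0_1); intros y _.
    apply (RInt_correct f c y), cts_ex_RInt; auto. }
  split; auto; intros x.
  apply (ex_derive_continuous (fun x => RInt f c x) x); exists (f x); auto.
Qed.

Lemma antideriv_bound a b F f K : antideriv a b F f -> a <= b ->
  (forall x, a <= x <= b -> Rabs (f x) <= K) ->
  Rabs (F b - F a) <= K * (b - a).
Proof.
  intros [h1 h2] hab hf.
  destruct (MVT_gen F a b f) as [c [hc heq]].
  - rewrite Rmin_left, Rmax_right; auto.
  - intros x _; apply continuity_pt_filterlim, h1.
  - rewrite Rmin_left, Rmax_right in hc; auto.
    rewrite heq, Rabs_mult, (Rabs_pos_eq (b - a)) by lra.
    apply Rmult_le_compat_r; [lra|auto].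
Qed.

Lemma antideriv_zero a b F : antideriv a b F (fun _ => 0) -> a <= b -> F b = F a.
Proof.
  intros h hab; pose proof (antideriv_bound a b F _ 0 h hab) as hb.
  specialize (hb ltac:(intros; cbv beta; rewrite Rabs_R0; lra)).
  assert (Rabs (F b - F a) <= 0) by lra.
  revert H; unfold Rabs; destruct Rcase_abs; lra.
Qed.

(** F and the integral of f have the same derivative inside and are continuous up to the ends, so
    their difference is constant; derivatives of F at a and b are never involved. *)
Lemma antideriv_FTC a b F f : antideriv a b F f -> cts f -> a <= b ->
  RInt f a b = F b - F a.
Proof.
  intros h hf hab.
  assert (h0 : antideriv a b (fun x => F x - RInt f a x) (fun _ => 0)).
  { eapply antideriv_ext; [apply antideriv_minus; [exact h|]|].
    - apply antideriv_RInt; exact hf.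
    - intros; simpl; ring. }
  apply antideriv_zero in h0; auto.
  rewrite RInt_point in h0; unfold zero in h0; simpl in h0; lra.
Qed.

Lemma deriv_on_clamp a g g' : 0 <= a -> deriv_on a g g' ->
  antideriv 0 a (fun x => g (clamp a x)) (fun x => g' (clamp a x)).
Proof.
  intros ha h; split.
  - apply continuous_on_clamp; auto.
    intros x hx P [e he].
    destruct (cont_deriv g g' (itv a) x (h x hx) e (cond_pos e)) as [d [hd H]].
    exists (mkposreal d hd); intros y hy hyD; apply he.
    (* [cont_deriv] yields a limit over points other than x. *)
    destruct (Req_dec x y) as [<-|hxy].
    { apply ball_center. }
    apply H; split; [split; auto|exact hy].
  - intros x hx.
    assert (hxi : itv a x) by (unfold itv; lra).
    apply is_derive_ext_loc with g.
    { apply filter_imp with (2 := clamp_locally a x hx); intros y ->; auto. }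
    rewrite clamp_id by auto.
    apply is_derive_Reals; intros eps he.
    destruct (h x hxi eps he) as [d [hd H]].
    assert (hd' : 0 < Rmin d (Rmin x (a - x))).
    { repeat apply Rmin_glb_lt; lra. }
    exists (mkposreal _ hd'); intros k hk hk'; simpl in hk'.
    pose proof (Rmin_l d (Rmin x (a - x))); pose proof (Rmin_r d (Rmin x (a - x))).
    pose proof (Rmin_l x (a - x)); pose proof (Rmin_r x (a - x)).
    assert (hk2 := Rabs_def2 _ _ hk').
    specialize (H (x + k)); simpl in H; unfold Rdist in H.
    replace (x + k - x) with k in H by ring.
    apply H; split; [|lra]; unfold D_x, itv; repeat split; lra.
Qed.

Lemma antideriv_taylor1 h F f K : 0 <= h -> antideriv 0 h F f ->
  (forall s, 0 <= s <= h -> Rabs (f s - f 0) <= K) ->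
  Rabs (F h - F 0 - h * f 0) <= K * h.
Proof.
  intros hh hF hf.
  assert (h0 : antideriv 0 h (fun s => F s - f 0 * s) (fun s => f s - f 0)).
  { eapply antideriv_ext;
      [apply antideriv_minus; [exact hF|apply antideriv_scal, antideriv_id]|].
    intros; simpl; ring. }
  pose proof (antideriv_bound _ _ _ _ K h0 hh hf) as hb; simpl in hb.
  replace (F h - F 0 - h * f 0) with (F h - f 0 * h - (F 0 - f 0 * 0)) by ring.
  replace (K * h) with (K * (h - 0)) by ring; exact hb.
Qed.

Lemma taylor_order1 h F F1 F2 K : 0 <= h -> 0 <= K ->
  antideriv 0 h F F1 -> antideriv 0 h F1 F2 ->
  (forall s, 0 <= s <= h -> Rabs (F2 s) <= K) ->
  Rabs (F h - F 0 - h * F1 0) <= K * h ^ 2.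
Proof.
  intros hh hK h1 h2 hf.
  replace (K * h ^ 2) with (K * h * h) by ring.
  apply antideriv_taylor1; auto; intros s hs.
  apply Rle_trans with (K * (s - 0)); [|nra].
  apply antideriv_bound with F2; [|lra|].
  - apply (antideriv_sub 0 h); auto; lra.
  - intros; apply hf; lra.
Qed.

(** The oscillation of [F2] is controlled instead of a third derivative, so that the lemma covers
    [utt], which is Lipschitz in time, as well as [uxtt], which is merely continuous. Sharp
    constants are not sought. *)
Lemma taylor_order2 h F F1 F2 K : 0 <= h -> 0 <= K ->
  antideriv 0 h F F1 -> antideriv 0 h F1 F2 ->
  (forall s, 0 <= s <= h -> Rabs (F2 s - F2 0) <= K) ->
  Rabs (F h - F 0 - h * F1 0 - h ^ 2 / 2 * F2 0) <= K * h ^ 2.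
Proof.
  intros hh hK h1 h2 hf.
  assert (h0 : antideriv 0 h (fun s => F s - (F1 0 * s + F2 0 / 2 * (s * s)))
    (fun s => F1 s - F1 0 - s * F2 0)).
  { eapply antideriv_ext;
      [apply antideriv_minus; [exact h1|apply antideriv_plus]|];
      [apply antideriv_scal, antideriv_id
      |apply antideriv_scal, antideriv_mult; apply antideriv_id|].
    intros; simpl; field. }
  pose proof (antideriv_bound _ _ _ _ (K * h) h0 hh) as hb; simpl in hb.
  replace (F h - F 0 - h * F1 0 - h ^ 2 / 2 * F2 0) with
    (F h - (F1 0 * h + F2 0 / 2 * (h * h))
     - (F 0 - (F1 0 * 0 + F2 0 / 2 * (0 * 0)))) by field.
  replace (K * h ^ 2) with (K * h * (h - 0)) by ring; apply hb.
  intros s hs; apply Rle_trans with (K * s); [|nra].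
  apply antideriv_taylor1; [lra| |].
  - apply (antideriv_sub 0 h); auto; lra.
  - intros; apply hf; lra.
Qed.

Lemma antideriv_even_part t h F f : 0 <= h -> antideriv (t - h) (t + h) F f ->
  antideriv 0 h (fun s => F (t + 1 * s) + F (t + -1 * s))
    (fun s => f (t + 1 * s) - f (t + -1 * s)).
Proof.
  intros hh hF; eapply antideriv_ext.
  - apply antideriv_plus; (apply antideriv_shift; [auto|]);
      (eapply antideriv_sub; [exact hF| |]);
      unfold Rmin, Rmax; destruct Rle_dec; lra.
  - intros; simpl; ring.
Qed.

Lemma antideriv_odd_part t h F f : 0 <= h -> antideriv (t - h) (t + h) F f ->
  antideriv 0 h (fun s => F (t + 1 * s) - F (t + -1 * s))
    (fun s => f (t + 1 * s) + f (t + -1 * s)).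
Proof.
  intros hh hF; eapply antideriv_ext.
  - apply antideriv_minus; (apply antideriv_shift; [auto|]);
      (eapply antideriv_sub; [exact hF| |]);
      unfold Rmin, Rmax; destruct Rle_dec; lra.
  - intros; simpl; ring.
Qed.

Lemma second_difference_order2 t h F f L : 0 <= h -> 0 <= L ->
  antideriv (t - h) (t + h) F f ->
  (forall r s, t - h <= r <= t + h -> t - h <= s <= t + h ->
    Rabs (f r - f s) <= L * Rabs (r - s)) ->
  Rabs (F (t + h) - 2 * F t + F (t - h)) <= 2 * L * h ^ 2.
Proof.
  intros hh hL hF hf.
  pose proof (antideriv_bound _ _ _ _ (2 * L * h)
    (antideriv_even_part t h F f hh hF) hh) as hb; simpl in hb.
  replace (t + 1 * h) with (t + h) in hb by ring.
  replace (t + -1 * h) with (t - h) in hb by ring.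
  replace (t + 1 * 0) with t in hb by ring.
  replace (t + -1 * 0) with t in hb by ring.
  replace (F (t + h) - 2 * F t + F (t - h)) with
    (F (t + h) + F (t - h) - (F t + F t)) by ring.
  replace (2 * L * h ^ 2) with (2 * L * h * (h - 0)) by ring; apply hb.
  intros s hs; eapply Rle_trans; [apply hf; lra|].
  replace (t + 1 * s - (t + -1 * s)) with (2 * s) by ring.
  rewrite Rabs_pos_eq by lra; nra.
Qed.

(** The Lipschitz bound on [F3] replaces a fourth derivative. It makes the second difference of [F2]
    of order s^2; integrating the symmetric combinations of [F1] and then of F gains one power each
    time, and the odd Taylor terms cancel by symmetry. *)
Lemma second_difference_order4 t h F F1 F2 F3 L : 0 <= h -> 0 <= L ->
  antideriv (t - h) (t + h) F F1 -> antideriv (t - h) (t + h) F1 F2 ->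
  antideriv (t - h) (t + h) F2 F3 ->
  (forall r s, t - h <= r <= t + h -> t - h <= s <= t + h ->
    Rabs (F3 r - F3 s) <= L * Rabs (r - s)) ->
  Rabs (F (t + h) - 2 * F t + F (t - h) - h ^ 2 * F2 t) <= 2 * L * h ^ 4.
Proof.
  intros hh hL hF hF1 hF2 hf.
  assert (b2 : forall s, 0 <= s <= h ->
    Rabs (F2 (t + 1 * s) + F2 (t + -1 * s) - 2 * F2 t) <= 2 * L * h ^ 2).
  { intros s hs; apply Rle_trans with (2 * L * s ^ 2).
    - replace (F2 (t + 1 * s) + F2 (t + -1 * s) - 2 * F2 t) with
        (F2 (t + s) - 2 * F2 t + F2 (t - s))
        by (replace (t + 1 * s) with (t + s) by ring;
            replace (t + -1 * s) with (t - s) by ring; ring).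
      apply second_difference_order2 with F3; try lra.
      + apply (antideriv_sub (t - h) (t + h)); auto; lra.
      + intros; apply hf; lra.
    - apply Rmult_le_compat_l; [lra|]; apply pow_incr; lra. }
  assert (b1 : forall s, 0 <= s <= h ->
    Rabs (F1 (t + 1 * s) - F1 (t + -1 * s) - 2 * F2 t * s) <= 2 * L * h ^ 3).
  { intros s hs.
    assert (h0 : antideriv 0 s
      (fun s => F1 (t + 1 * s) - F1 (t + -1 * s) - 2 * F2 t * s)
      (fun s => F2 (t + 1 * s) + F2 (t + -1 * s) - 2 * F2 t)).
    { eapply antideriv_ext; [apply antideriv_minus; [apply antideriv_odd_part|]|].
      - lra.
      - apply (antideriv_sub (t - h) (t + h)); [exact hF1| |]; lra.
      - apply antideriv_scal, antideriv_id.
      - intros; simpl; ring. }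
    pose proof (antideriv_bound _ _ _ _ (2 * L * h ^ 2) h0) as hb; simpl in hb.
    replace (F1 (t + 1 * s) - F1 (t + -1 * s) - 2 * F2 t * s) with
      (F1 (t + 1 * s) - F1 (t + -1 * s) - 2 * F2 t * s
        - (F1 (t + 1 * 0) - F1 (t + -1 * 0) - 2 * F2 t * 0))
      by (replace (t + 1 * 0) with t by ring;
          replace (t + -1 * 0) with t by ring; ring).
    apply Rle_trans with (2 * L * h ^ 2 * (s - 0)).
    - apply hb; [lra|]; intros; apply b2; lra.
    - replace (2 * L * h ^ 3) with (2 * L * h ^ 2 * h) by ring.
      apply Rmult_le_compat_l; [|lra].
      apply Rmult_le_pos; [lra|apply pow_le; auto]. }
  assert (h0 : antideriv 0 h
    (fun s => F (t + 1 * s) + F (t + -1 * s) - F2 t * (s * s))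
    (fun s => F1 (t + 1 * s) - F1 (t + -1 * s) - 2 * F2 t * s)).
  { eapply antideriv_ext; [apply antideriv_minus; [apply antideriv_even_part|]|].
    - auto.
    - exact hF.
    - apply antideriv_scal, antideriv_mult; apply antideriv_id.
    - intros; simpl; ring. }
  pose proof (antideriv_bound _ _ _ _ (2 * L * h ^ 3) h0 hh b1) as hb.
  simpl in hb.
  replace (t + 1 * h) with (t + h) in hb by ring.
  replace (t + -1 * h) with (t - h) in hb by ring.
  replace (t + 1 * 0) with t in hb by ring.
  replace (t + -1 * 0) with t in hb by ring.
  replace (F (t + h) - 2 * F t + F (t - h) - h ^ 2 * F2 t) with
    (F (t + h) + F (t - h) - F2 t * (h * h) - (F t + F t - F2 t * (0 * 0)))
    by ring.
  replace (2 * L * h ^ 4) with (2 * L * h ^ 3 * (h - 0)) by ring; exact hb.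
Qed.

(* For every eps there are F and a scale s with F' ~ s b and F ~ s a up to
   eps s; dividing by s identifies a with the integral of b. *)
Lemma antideriv_of_approx l a b : 0 < l -> cts a -> cts b ->
  (forall eps, 0 < eps -> exists F F' s, 0 < s /\ antideriv 0 l F F' /\
    F 0 = 0 /\ (forall x, 0 <= x <= l -> Rabs (F' x - s * b x) <= eps * s) /\
    (forall x, 0 <= x <= l -> Rabs (F x - s * a x) <= eps * s)) ->
  antideriv 0 l a b.
Proof.
  intros hl ha hb H.
  assert (hab : forall x, 0 <= x <= l -> a x = RInt b 0 x).
  { intros x hx.
    assert (hle : Rabs (a x - RInt b 0 x) <= 0).
    { apply le_epsilon; intros e he.
      (* The two errors add up to eps * s * (x + 1) with x <= l, hence the division by l + 1. *)
      destruct (H (e / (l + 1))) as [F [F' [s [hs [hF [hF0 [hF' hFa]]]]]]].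
      { apply Rdiv_lt_0_compat; lra. }
      set (eps := e / (l + 1)) in *.
      assert (heps : eps * (l + 1) = e) by (unfold eps; field; lra).
      assert (heps0 : 0 < eps) by (apply Rdiv_lt_0_compat; lra).
      clearbody eps.
      assert (h0 : antideriv 0 x (fun x => F x - s * RInt b 0 x)
        (fun x => F' x - s * b x)).
      { apply antideriv_minus;
          [apply (antideriv_sub 0 l); auto; lra|].
        apply antideriv_scal, antideriv_RInt; auto. }
      pose proof (antideriv_bound _ _ _ _ (eps * s) h0) as hbd; simpl in hbd.
      rewrite RInt_point in hbd; unfold zero in hbd; simpl in hbd.
      rewrite hF0 in hbd.
      specialize (hbd ltac:(lra) ltac:(intros; apply hF'; lra)).
      specialize (hFa x hx).
      assert (h1 : Rabs (s * a x - s * RInt b 0 x) <= eps * s * (x + 1)).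
      { revert hFa hbd; unfold Rabs; repeat destruct Rcase_abs; nra. }
      rewrite <- Rmult_minus_distr_l, Rabs_mult, (Rabs_pos_eq s) in h1 by lra.
      assert (h2 : s * Rabs (a x - RInt b 0 x) <= s * (eps * (l + 1))).
      { assert (0 <= eps * s * (l - x)) by (repeat apply Rmult_le_pos; lra).
        nra. }
      apply Rmult_le_reg_l in h2; lra. }
    revert hle; unfold Rabs; destruct Rcase_abs; lra. }
  split; auto; intros x hx.
  apply is_derive_ext_loc with (fun x => RInt b 0 x).
  - assert (hd : 0 < Rmin x (l - x)) by (apply Rmin_glb_lt; lra).
    exists (mkposreal _ hd); intros y hy; symmetry; apply hab.
    change (Rabs (y - x) < Rmin x (l - x)) in hy.
    pose proof (Rmin_l x (l - x)); pose proof (Rmin_r x (l - x)).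
    apply Rabs_def2 in hy; lra.
  - apply (antideriv_RInt 0 l 0 b hb); auto.
Qed.

(** * Integrals of continuous functions *)

Lemma RIntR_plus f g a b : cts f -> cts g ->
  RInt (fun x => f x + g x) a b = RInt f a b + RInt g a b.
Proof. intros hf hg; apply (RInt_plus f g); apply cts_ex_RInt; auto. Qed.

Lemma RIntR_scal c f a b : cts f -> RInt (fun x => c * f x) a b = c * RInt f a b.
Proof. intros hf; apply (RInt_scal f); apply cts_ex_RInt; auto. Qed.

Lemma RIntR_minus f g a b : cts f -> cts g ->
  RInt (fun x => f x - g x) a b = RInt f a b - RInt g a b.
Proof. intros hf hg; apply (RInt_minus f g); apply cts_ex_RInt; auto. Qed.

Lemma RIntR_ext (f g : R -> R) l : 0 <= l -> (forall x, 0 < x < l -> f x = g x) ->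
  RInt f 0 l = RInt g 0 l.
Proof.
  intros hl h; apply RInt_ext; intros x hx.
  rewrite Rmin_left, Rmax_right in hx by auto; apply h, hx.
Qed.

Lemma RInt_sqr_pos f l : 0 <= l -> cts f -> 0 <= RInt (fun x => f x ^ 2) 0 l.
Proof.
  intros hl hf; apply RInt_ge_0; auto; [apply cts_ex_RInt; cts_tac|].
  intros; apply pow2_ge_0.
Qed.

Lemma RInt_le_const f l c : 0 <= l -> cts f -> (forall x, 0 < x < l -> f x <= c) ->
  RInt f 0 l <= l * c.
Proof.
  intros hl hf h.
  replace (l * c) with (RInt (fun _ => c) 0 l)
    by (rewrite RInt_const; unfold scal; simpl; unfold mult; simpl; ring).
  apply RInt_le; auto; apply cts_ex_RInt; cts_tac.
Qed.

Lemma discriminant_nonpos a b c : 0 <= a -> 0 <= c ->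
  (forall s, 0 <= a * s ^ 2 + 2 * b * s + c) -> b ^ 2 <= a * c.
Proof.
  intros ha hc h.
  destruct (Req_dec a 0) as [->|ha0].
  - destruct (Req_dec b 0) as [->|hb]; [lra|].
    (* With a = 0 the polynomial is affine in s, and this s gives it the value -1. *)
    specialize (h (- (c + 1) / (2 * b))).
    replace (0 * (- (c + 1) / (2 * b)) ^ 2 + 2 * b * (- (c + 1) / (2 * b)) + c)
      with (-1) in h by (field; auto); lra.
  (* The minimum point of the quadratic. *)
  - specialize (h (- b / a)).
    replace (a * (- b / a) ^ 2 + 2 * b * (- b / a) + c) with
      ((a * c - b ^ 2) / a) in h by (field; auto).
    apply (Rmult_le_compat_l a) in h; [|lra].
    replace (a * ((a * c - b ^ 2) / a)) with (a * c - b ^ 2) in h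
      by (field; auto); lra.
Qed.

Lemma RInt_Cauchy_Schwarz f g l : 0 <= l -> cts f -> cts g ->
  RInt (fun x => f x * g x) 0 l ^ 2
    <= RInt (fun x => f x ^ 2) 0 l * RInt (fun x => g x ^ 2) 0 l.
Proof.
  intros hl hf hg; apply discriminant_nonpos; try (apply RInt_sqr_pos; auto).
  intros s.
  assert (h : 0 <= RInt (fun x => (s * f x + g x) ^ 2) 0 l)
    by (apply RInt_sqr_pos; auto; cts_tac).
  rewrite (RIntR_ext (fun x => (s * f x + g x) ^ 2)
    (fun x => s ^ 2 * f x ^ 2 + 2 * s * (f x * g x) + g x ^ 2) l) in h
    by (auto; intros; ring).
  rewrite !RIntR_plus, !RIntR_scal in h by cts_tac.
  nra.
Qed.

Lemma RInt_by_parts l F f G g : 0 <= l -> antideriv 0 l F f ->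
  antideriv 0 l G g -> cts f -> cts g -> G 0 = 0 -> G l = 0 ->
  RInt (fun x => f x * G x) 0 l = - RInt (fun x => F x * g x) 0 l.
Proof.
  intros hl hF hG hf hg h0 h1.
  pose proof (antideriv_FTC _ _ _ _ (antideriv_mult _ _ _ _ _ _ hF hG)) as h.
  destruct hF as [hF _], hG as [hG _]; simpl in h.
  rewrite RIntR_plus, h0, h1 in h by (cts_tac).
  assert (h2 := h ltac:(cts_tac) hl); lra.
Qed.

(** * The energy identity *)

(* a, b, c are the errors at levels k+1, k, k-1; the equation is tested with
   a - c. *)
Lemma energy_identity l tau q a a' b c c' s' s'' g :
  0 < l -> 0 < tau ->
  antideriv 0 l a a' -> antideriv 0 l c c' -> cts b ->
  cts a' -> cts c' ->
  antideriv 0 l s' s'' -> cts s'' -> cts g ->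
  (forall x, 0 < x < l -> s' x = a' x + c' x) ->
  a 0 = 0 -> a l = 0 -> c 0 = 0 -> c l = 0 ->
  (forall x, 0 < x < l ->
    (a x - 2 * b x + c x) / tau ^ 2 - 1 / 2 * q * s'' x = g x) ->
  RInt (fun x => ((a x - b x) / tau) ^ 2) 0 l
    - RInt (fun x => ((b x - c x) / tau) ^ 2) 0 l
    + q / 2 * (RInt (fun x => a' x ^ 2) 0 l - RInt (fun x => c' x ^ 2) 0 l)
  = RInt (fun x => g x * (a x - c x)) 0 l.
Proof.
  intros hl ht ha hc hb ha' hc' hs hs'' hg hs' a0 al c0 cl heq.
  assert (ca := proj1 ha); assert (cc := proj1 hc); assert (cs' := proj1 hs).
  (* This is (a - 2 b + c)(a - c) = (a - b)^2 - (b - c)^2. *)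
  rewrite (RIntR_ext (fun x => g x * (a x - c x)) (fun x =>
    ((a x - b x) / tau) ^ 2 - ((b x - c x) / tau) ^ 2
      - q / 2 * (s'' x * (a x - c x))) l); [|lra|].
  2: { intros x hx; rewrite <- heq by auto; field; lra. }
  rewrite !RIntR_minus, RIntR_scal by cts_tac.
  rewrite (RInt_by_parts l s' s'' (fun x => a x - c x) (fun x => a' x - c' x));
    try first [assumption | cts_tac; lra].
  2: { apply antideriv_minus; auto. }
  (* Since s' = a' + c', the product is a difference of squares and the elliptic term telescopes
     over two levels. *)
  rewrite (RIntR_ext (fun x => s' x * (a' x - c' x))
    (fun x => a' x ^ 2 - c' x ^ 2) l); [|lra|].
  2: { intros x hx; rewrite hs' by auto; ring. }
  rewrite RIntR_minus by cts_tac; ring.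
Qed.

Lemma RInt_Young l g d e : 0 <= l -> cts g -> cts d -> cts e ->
  RInt (fun x => g x * (d x + e x)) 0 l
    <= RInt (fun x => g x ^ 2) 0 l
       + (RInt (fun x => d x ^ 2) 0 l + RInt (fun x => e x ^ 2) 0 l) / 2.
Proof.
  intros hl hg hd he.
  replace (RInt (fun x => g x ^ 2) 0 l
    + (RInt (fun x => d x ^ 2) 0 l + RInt (fun x => e x ^ 2) 0 l) / 2)
    with (RInt (fun x => g x ^ 2 + (1 / 2 * d x ^ 2 + 1 / 2 * e x ^ 2)) 0 l).
  2: { rewrite !RIntR_plus, !RIntR_scal by cts_tac.
       match goal with |- _ = ?r => change (@eq R
         (RInt (fun x => g x ^ 2) 0 l + (1 / 2 * RInt (fun x => d x ^ 2) 0 l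
            + 1 / 2 * RInt (fun x => e x ^ 2) 0 l)) r) end; field. }
  apply RInt_le; auto; try (apply cts_ex_RInt; cts_tac).
  intros x _.
  (* The first square gives g (d + e) <= g^2 + (d + e)^2 / 4, the second (d + e)^2 <= 2 (d^2 +
     e^2). *)
  pose proof (pow2_ge_0 (g x - (d x + e x) / 2)).
  pose proof (pow2_ge_0 (d x - e x)); nra.
Qed.

(** * Discrete energy growth *)

(** E1 - E0 equals the left side of the energy inequality plus (q1 - q0) / 2 * (N1 + N0). Multiples
    of N1 + N0 are charged to E0 through c0 / 2 * (N1 + N0) <= E0, whence the ratio C / c0. *)
Lemma energy_growth tau C c0 q0 q1 D0 D1 N0 N1 N2 G :
  0 < tau <= 1 -> 0 < c0 -> 0 <= C -> c0 <= q0 -> c0 <= q1 ->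
  0 <= D0 -> 0 <= D1 -> 0 <= N0 -> 0 <= N1 -> 0 <= N2 ->
  Rabs (q1 - q0) <= C * tau ->
  D1 - D0 + q1 / 2 * (N2 - N0) <= tau * (G + (D1 + D0) / 2) ->
  G <= C * tau ^ 4 + C * N1 ->
  let K := 6 * (C / c0) + 2 * C + 2 in
  D1 + q1 / 2 * (N2 + N1)
    <= (1 + K * tau) * (D0 + q0 / 2 * (N1 + N0)) + K * tau ^ 5.
Proof.
  intros [ht ht1] hc0 hC hq0 hq1 hD0 hD1 hN0 hN1 hN2 hq hE hG K.
  set (E0 := D0 + q0 / 2 * (N1 + N0)); set (E1 := D1 + q1 / 2 * (N2 + N1)).
  set (c := C / c0).
  assert (hc : 0 <= c) by (apply Rdiv_le_0_compat; lra).
  assert (hcC : C = c * c0) by (unfold c; field; lra).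
  assert (hN : c0 / 2 * (N1 + N0) <= E0).
  { unfold E0; assert (0 <= (q0 - c0) * (N1 + N0)) by (apply Rmult_le_pos; lra).
    lra. }
  assert (hCN : C * (N1 + N0) <= 2 * c * E0).
  { rewrite hcC; apply (Rmult_le_compat_l (2 * c)) in hN; lra. }
  assert (hCN0 : 0 <= C * N0) by (apply Rmult_le_pos; lra).
  assert (hD0E : D0 <= E0).
  { unfold E0; assert (0 <= q0 * (N1 + N0)) by (apply Rmult_le_pos; lra); lra. }
  assert (hD1E : D1 <= E1).
  { unfold E1; assert (0 <= q1 * (N2 + N1)) by (apply Rmult_le_pos; lra); lra. }
  assert (hqN : (q1 - q0) * (N1 + N0) <= tau * (2 * c * E0)).
  { apply Rle_trans with (C * tau * (N1 + N0)).
    - apply Rmult_le_compat_r; [lra|].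
      apply Rle_trans with (2 := hq), RRle_abs.
    - replace (C * tau * (N1 + N0)) with (tau * (C * (N1 + N0))) by ring.
      apply Rmult_le_compat_l; lra. }
  assert (hsum : tau * (G + (D1 + D0) / 2)
    <= tau * (C * tau ^ 4 + 2 * c * E0 + (E1 + E0) / 2)).
  { apply Rmult_le_compat_l; lra. }
  assert (hE1 : E1 * (1 - tau / 2)
    <= E0 * (1 + tau * (3 * c + 1 / 2)) + C * tau ^ 5).
  { replace (E1 * (1 - tau / 2)) with (E1 - tau * (E1 / 2)) by field.
    unfold E1 at 1; unfold E0 in *; nra. }
  assert (hE00 : 0 <= E0) by lra.
  assert (hE10 : 0 <= E1) by lra.
  (* The share tau / 2 * E1 on the right is absorbed because (1 - tau / 2)(1 + tau) = 1 + tau (1 -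
     tau) / 2 >= 1 for tau <= 1. *)
  assert (h1 : E1 <= E1 * (1 - tau / 2) * (1 + tau)).
  { replace (E1 * (1 - tau / 2) * (1 + tau)) with
      (E1 + E1 * (tau / 2 * (1 - tau))) by field.
    assert (0 <= E1 * (tau / 2 * (1 - tau))); [|lra].
    apply Rmult_le_pos; [lra|apply Rmult_le_pos; lra]. }
  apply (Rmult_le_compat_r (1 + tau)) in hE1; [|lra].
  apply Rle_trans with (1 := h1), Rle_trans with (1 := hE1).
  assert (ht5 : 0 <= tau ^ 5) by (apply pow_le; lra).
  assert (h2 : C * tau ^ 5 * (1 + tau) <= K * tau ^ 5).
  { replace (C * tau ^ 5 * (1 + tau)) with (C * (1 + tau) * tau ^ 5) by ring.
    apply Rmult_le_compat_r; auto; unfold K; fold c; nra. }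
  (* For tau <= 1, (1 + tau y)(1 + tau) <= 1 + tau (2 y + 1); with y = 3 c + 1 / 2 this is the
     origin of 6 (C / c0) + 2 in [K]. *)
  assert (h3 : E0 * (1 + tau * (3 * c + 1 / 2)) * (1 + tau)
    <= (1 + K * tau) * E0).
  { replace (E0 * (1 + tau * (3 * c + 1 / 2)) * (1 + tau)) with
      ((1 + tau * (3 * c + 1 / 2 + 1 + tau * (3 * c + 1 / 2))) * E0) by field.
    apply Rmult_le_compat_r; auto.
    apply Rplus_le_compat_l; rewrite (Rmult_comm K).
    apply Rmult_le_compat_l; [lra|]; unfold K; fold c.
    assert (0 <= (1 - tau) * (3 * c + 1 / 2)) by (apply Rmult_le_pos; lra).
    lra. }
  lra.
Qed.

Lemma pow_le_exp x k : 0 <= x -> (1 + x) ^ k <= exp (INR k * x).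
Proof.
  intros hx; induction k as [|k IH].
  - simpl; rewrite Rmult_0_l, exp_0; lra.
  - rewrite S_INR, Rmult_plus_distr_r, exp_plus, Rmult_1_l.
    simpl; rewrite Rmult_comm.
    apply Rmult_le_compat; try lra; [apply pow_le; lra|apply exp_ineq1_le].
Qed.

(* The bound N k <= tau^2 needed to control the coefficients at level k is
   weaker than the bound O(tau^4) already obtained, once tau is small. *)
Lemma energy_bootstrap (n : nat) tau T C c0 K0 (q D N : nat -> R) :
  let K := 6 * (C / c0) + 2 * C + 2 in
  let M := (K0 + 1) * exp (K * T) in
  0 < tau <= 1 -> INR n * tau <= T -> 0 < c0 -> 0 <= C -> 0 <= K0 ->
  2 * M / c0 * tau ^ 2 <= 1 ->
  (forall k, (k < n)%nat -> c0 <= q k) ->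
  (forall k, (k <= n)%nat -> 0 <= N k) -> (forall k, (k < n)%nat -> 0 <= D k) ->
  N 0%nat = 0 ->
  D 0%nat + q 0%nat / 2 * (N 1%nat + N 0%nat) <= K0 * tau ^ 4 ->
  (forall k, (S k < n)%nat -> N k <= tau ^ 2 -> N (S k) <= tau ^ 2 ->
    Rabs (q (S k) - q k) <= C * tau /\
    exists G, G <= C * tau ^ 4 + C * N (S k) /\
      D (S k) - D k + q (S k) / 2 * (N (S (S k)) - N k)
        <= tau * (G + (D (S k) + D k) / 2)) ->
  forall k, (k < n)%nat -> D k <= M * tau ^ 4 /\ N (S k) <= 2 * M / c0 * tau ^ 4.
Proof.
  intros K M [ht ht1] hnT hc0 hC hK0 hsmall hq hN hD hN0 hinit hstep.
  assert (hcc : 0 <= C / c0) by (apply Rdiv_le_0_compat; lra).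
  assert (hK : 0 <= K) by (unfold K; lra).
  assert (ht4 : 0 <= tau ^ 4) by (apply pow_le; lra).
  set (E := fun k => D k + q k / 2 * (N (S k) + N k)).
  assert (hexp : forall k, (k <= n)%nat -> (1 + K * tau) ^ k <= exp (K * T)).
  { intros k hk; apply Rle_trans with (exp (INR k * (K * tau))).
    - apply pow_le_exp; apply Rmult_le_pos; lra.
    - assert (h : INR k * (K * tau) <= K * T).
      { replace (INR k * (K * tau)) with (K * (INR k * tau)) by ring.
        apply Rmult_le_compat_l; auto.
        apply Rle_trans with (2 := hnT), Rmult_le_compat_r; [lra|].
        apply le_INR; auto. }
      destruct (Rle_lt_or_eq_dec _ _ h) as [h'|<-]; [|lra].
      left; apply exp_increasing; auto. }
  assert (hfin : forall k, (k < n)%nat ->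
    E k + tau ^ 4 <= (1 + K * tau) ^ k * ((K0 + 1) * tau ^ 4) ->
    D k <= M * tau ^ 4 /\ N (S k) <= 2 * M / c0 * tau ^ 4).
  { intros k hk hE.
    assert (hE2 : E k <= M * tau ^ 4).
    { assert (h : (1 + K * tau) ^ k * ((K0 + 1) * tau ^ 4)
        <= exp (K * T) * ((K0 + 1) * tau ^ 4)).
      { apply Rmult_le_compat_r; [apply Rmult_le_pos; lra|].
        apply hexp; lia. }
      unfold M; lra. }
    assert (hqk := hq k hk); assert (hDk := hD k hk).
    assert (hN1 := hN (S k) ltac:(lia)); assert (hN2 := hN k ltac:(lia)).
    unfold E in hE2.
    assert (0 <= (q k - c0) * (N (S k) + N k)) by (apply Rmult_le_pos; lra).
    assert (0 <= c0 * (N (S k) + N k)) by (apply Rmult_le_pos; lra).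
    assert (0 <= c0 * N k) by (apply Rmult_le_pos; lra).
    split; [lra|].
    apply Rmult_le_reg_l with (c0 / 2); [lra|].
    replace (c0 / 2 * (2 * M / c0 * tau ^ 4)) with (M * tau ^ 4) by (field; lra).
    lra. }
  assert (hsm : forall k, (k < n)%nat -> N (S k) <= 2 * M / c0 * tau ^ 4 ->
    N (S k) <= tau ^ 2).
  { intros k _ h; apply Rle_trans with (1 := h).
    replace (2 * M / c0 * tau ^ 4) with (2 * M / c0 * tau ^ 2 * tau ^ 2) by ring.
    assert (0 <= tau ^ 2) by (apply pow_le; lra); nra. }
  (* Adding tau^4 to the energy absorbs the source: E (k+1) + tau^4 <= (1 + K tau)(E k + tau^4), and
     it accounts for the 1 in K0 + 1. The bound on [N k] is carried along because [hstep] needs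
     smallness at two consecutive levels. *)
  assert (main : forall k, (k < n)%nat -> N k <= tau ^ 2 /\
    E k + tau ^ 4 <= (1 + K * tau) ^ k * ((K0 + 1) * tau ^ 4)).
  { induction k as [|k IH]; intros hk.
    - split; [rewrite hN0; apply pow_le; lra|].
      unfold E; simpl pow at 2; lra.
    - destruct (IH ltac:(lia)) as [hNk hEk].
      destruct (hfin k ltac:(lia) hEk) as [_ hNSk].
      assert (hNSk' := hsm k ltac:(lia) hNSk); split; auto.
      destruct (hstep k hk hNk hNSk') as [hqq [G [hG hE]]].
      assert (h := energy_growth tau C c0 (q k) (q (S k)) (D k) (D (S k)) (N k)
        (N (S k)) (N (S (S k))) G (conj ht ht1) hc0 hC (hq k ltac:(lia))
        (hq (S k) hk) (hD k ltac:(lia)) (hD (S k) hk) (hN k ltac:(lia))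
        (hN (S k) ltac:(lia)) (hN (S (S k)) ltac:(lia)) hqq hE hG).
      simpl in h; change (6 * (C / c0) + 2 * C + 2) with K in h.
      change (E (S k)) with
        (D (S k) + q (S k) / 2 * (N (S (S k)) + N (S k))).
      change (D k + q k / 2 * (N (S k) + N k)) with (E k) in h.
      replace ((1 + K * tau) ^ S k * ((K0 + 1) * tau ^ 4)) with
        ((1 + K * tau) * ((1 + K * tau) ^ k * ((K0 + 1) * tau ^ 4)))
        by (simpl; ring).
      apply Rle_trans with ((1 + K * tau) * (E k + tau ^ 4)); [simpl; lra|].
      apply Rmult_le_compat_l; [nra|auto]. }
  intros k hk; apply hfin; auto; apply main; auto.
Qed.

(** * Functions of space and time *)

Lemma small_step T B eps : 0 < T -> 0 < B -> 0 < eps ->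
  exists h, 0 < h /\ h <= T /\ B * h <= eps.
Proof.
  intros hT hB he; assert (0 < eps / B) by (apply Rdiv_lt_0_compat; lra).
  exists (Rmin T (eps / B)); split; [apply Rmin_glb_lt; lra|].
  split; [apply Rmin_l|].
  apply Rle_trans with (B * (eps / B)).
  - apply Rmult_le_compat_l; [lra|apply Rmin_r].
  - right; field; lra.
Qed.

Lemma deriv_on_lipschitz a g g' K : 0 <= a -> deriv_on a g g' ->
  (forall x, itv a x -> Rabs (g' x) <= K) ->
  forall x y, itv a x -> itv a y -> Rabs (g x - g y) <= K * Rabs (x - y).
Proof.
  intros ha hg hK.
  assert (h : forall x y, itv a x -> itv a y -> y <= x ->
    Rabs (g x - g y) <= K * Rabs (x - y)).
  { intros x y hx hy hyx.
    pose proof (antideriv_bound y x _ _ K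
      (antideriv_sub _ _ y x _ _ (deriv_on_clamp a g g' ha hg)
        (proj1 hy) (proj2 hx)) hyx) as h.
    cbv beta in h; rewrite !clamp_id in h by auto.
    rewrite (Rabs_pos_eq (x - y)) by lra; apply h.
    intros z _; apply hK, clamp_itv, ha. }
  intros x y hx hy; destruct (Rle_dec y x); auto.
  rewrite (Rabs_minus_sym (g x)), (Rabs_minus_sym x); apply h; auto; lra.
Qed.

Lemma dx_on_antideriv l T g gx t : 0 <= l -> dx_on l T g gx -> itv T t ->
  antideriv 0 l (fun x => g (clamp l x) t) (fun x => gx (clamp l x) t).
Proof.
  intros hl h ht.
  apply (deriv_on_clamp l (fun x => g x t) (fun x => gx x t)); auto.
Qed.

Lemma dt_on_antideriv l T g gt x : 0 <= T -> dt_on l T g gt -> itv l x ->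
  antideriv 0 T (fun t => g x (clamp T t)) (fun t => gt x (clamp T t)).
Proof. intros hT h hx; apply (deriv_on_clamp T (g x) (gt x)); auto. Qed.

Lemma dt_on_lipschitz l T g gt K : 0 <= T -> dt_on l T g gt ->
  (forall x t, itv l x -> itv T t -> Rabs (gt x t) <= K) ->
  forall x t s, itv l x -> itv T t -> itv T s ->
    Rabs (g x t - g x s) <= K * Rabs (t - s).
Proof. intros hT h hK x; intros; apply (deriv_on_lipschitz T _ (gt x)); auto. Qed.

Lemma lipschitz_t_pos l T g : lipschitz_t l T g -> exists L, 0 < L /\
  forall x t s, itv l x -> itv T t -> itv T s ->
    Rabs (g x t - g x s) <= L * Rabs (t - s).
Proof.
  intros [L hL]; exists (Rabs L + 1).
  split; [pose proof (Rabs_pos L); lra|]; intros x t s hx ht hs.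
  apply Rle_trans with (1 := hL x t s hx ht hs), Rmult_le_compat_r.
  - apply Rabs_pos.
  - pose proof (RRle_abs L); lra.
Qed.

Lemma dt_second_difference2 l T g gt : 0 <= T -> dt_on l T g gt ->
  lipschitz_t l T gt -> exists B, 0 < B /\ forall x t h, itv l x -> 0 <= h ->
    0 <= t - h -> t + h <= T ->
    Rabs (g x (t + h) - 2 * g x t + g x (t - h)) <= B * h ^ 2.
Proof.
  intros hT h1 hlip.
  destruct (lipschitz_t_pos _ _ _ hlip) as [L [hL HL]].
  exists (2 * L); split; [lra|]; intros x t h hx hh ht1 ht2.
  pose proof (second_difference_order2 t h _ _ L hh (Rlt_le _ _ hL)
    (antideriv_sub _ _ (t - h) (t + h) _ _ (dt_on_antideriv l T g gt x hT h1 hx)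
      ht1 ht2)) as H; cbv beta in H.
  rewrite !(clamp_id T) in H by (unfold itv; lra).
  apply H; intros r s hr hs; rewrite !(clamp_id T) by (unfold itv; lra).
  apply HL; auto; unfold itv; lra.
Qed.

Lemma dt_second_difference4 l T g g1 g2 g3 : 0 <= T -> dt_on l T g g1 ->
  dt_on l T g1 g2 -> dt_on l T g2 g3 ->
  lipschitz_t l T g3 -> exists B, 0 < B /\ forall x t h, itv l x -> 0 <= h ->
    0 <= t - h -> t + h <= T ->
    Rabs (g x (t + h) - 2 * g x t + g x (t - h) - h ^ 2 * g2 x t) <= B * h ^ 4.
Proof.
  intros hT h1 h2 h3 hlip.
  destruct (lipschitz_t_pos _ _ _ hlip) as [L [hL HL]].
  exists (2 * L); split; [lra|]; intros x t h hx hh ht1 ht2.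
  pose proof (second_difference_order4 t h _ _ _ _ L hh (Rlt_le _ _ hL)
    (antideriv_sub _ _ (t - h) (t + h) _ _ (dt_on_antideriv l T _ _ x hT h1 hx)
      ht1 ht2)
    (antideriv_sub _ _ (t - h) (t + h) _ _ (dt_on_antideriv l T _ _ x hT h2 hx)
      ht1 ht2)
    (antideriv_sub _ _ (t - h) (t + h) _ _ (dt_on_antideriv l T _ _ x hT h3 hx)
      ht1 ht2)) as H; cbv beta in H.
  rewrite !(clamp_id T) in H by (unfold itv; lra).
  apply H; intros r s hr hs; rewrite !(clamp_id T) by (unfold itv; lra).
  apply HL; auto; unfold itv; lra.
Qed.

Lemma dt_taylor1 l T g g1 g2 K x h : 0 <= T -> dt_on l T g g1 ->
  dt_on l T g1 g2 -> itv l x -> itv T h ->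
  (forall t, itv T t -> Rabs (g2 x t) <= K) ->
  Rabs (g x h - g x 0 - h * g1 x 0) <= K * h ^ 2.
Proof.
  intros hT h1 h2 hx hh hK.
  assert (hK0 : 0 <= K).
  { apply Rle_trans with (2 := hK h hh), Rabs_pos. }
  assert (i0 : itv T 0) by (unfold itv; lra).
  pose proof (taylor_order1 h _ _ _ K (proj1 hh) hK0
    (antideriv_sub _ _ 0 h _ _ (dt_on_antideriv l T _ _ x hT h1 hx)
      (Rle_refl 0) (proj2 hh))
    (antideriv_sub _ _ 0 h _ _ (dt_on_antideriv l T _ _ x hT h2 hx)
      (Rle_refl 0) (proj2 hh))) as H; cbv beta in H.
  rewrite !(clamp_id T) in H by auto.
  apply H; intros s _; apply hK, clamp_itv, hT.
Qed.

Lemma dt_taylor2 l T g g1 g2 K x h : 0 <= T -> dt_on l T g g1 ->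
  dt_on l T g1 g2 -> itv l x -> itv T h ->
  (forall t, 0 <= t <= h -> Rabs (g2 x t - g2 x 0) <= K) ->
  Rabs (g x h - g x 0 - h * g1 x 0 - h ^ 2 / 2 * g2 x 0) <= K * h ^ 2.
Proof.
  intros hT h1 h2 hx hh hK.
  assert (hK0 : 0 <= K).
  { apply Rle_trans with (2 := hK h ltac:(unfold itv in hh; lra)), Rabs_pos. }
  assert (i0 : itv T 0) by (unfold itv; lra).
  pose proof (taylor_order2 h _ _ _ K (proj1 hh) hK0
    (antideriv_sub _ _ 0 h _ _ (dt_on_antideriv l T _ _ x hT h1 hx)
      (Rle_refl 0) (proj2 hh))
    (antideriv_sub _ _ 0 h _ _ (dt_on_antideriv l T _ _ x hT h2 hx)
      (Rle_refl 0) (proj2 hh))) as H; cbv beta in H.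
  rewrite !(clamp_id T) in H by auto.
  apply H; intros s hs; rewrite !(clamp_id T) by (unfold itv in *; lra).
  apply hK; lra.
Qed.

(** Identities are first found inside the interval, where derivatives are two-sided and the
    differential equation holds; density and continuity carry them to the endpoints. *)
Lemma cts_eq_closed l f g : 0 < l -> cts f -> cts g ->
  (forall x, 0 < x < l -> f x = g x) -> forall x, itv l x -> f x = g x.
Proof.
  intros hl hf hg h x hx.
  assert (hd : cts (fun y => f y - g y)) by cts_tac.
  cut (Rabs (f x - g x) <= 0).
  { unfold Rabs; destruct Rcase_abs; lra. }
  apply le_epsilon; intros e he.
  destruct (cts_eps _ x hd e he) as [d [hd0 H]].
  assert (exists y, 0 < y < l /\ Rabs (y - x) < d) as [y [hy hyd]].
  { unfold itv in hx; set (m := Rmin d l / 2).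
    assert (0 < m /\ 2 * m <= d /\ 2 * m <= l) as [m1 [m2 m3]].
    { unfold m; pose proof (Rmin_l d l); pose proof (Rmin_r d l).
      assert (0 < Rmin d l) by (apply Rmin_glb_lt; lra); lra. }
    (* The nearby point is taken on the side of the farther endpoint, so that it stays inside. *)
    destruct (Rle_dec x (l / 2)).
    - exists (x + m / 2); split; [lra|].
      replace (x + m / 2 - x) with (m / 2) by ring.
      rewrite Rabs_pos_eq; lra.
    - exists (x - m / 2); split; [lra|].
      replace (x - m / 2 - x) with (- (m / 2)) by ring.
      rewrite Rabs_Ropp, Rabs_pos_eq; lra. }
  specialize (H y hyd); cbv beta in H; rewrite (h y hy) in H.
  replace (g y - g y - (f x - g x)) with (- (f x - g x)) in H by ring.
  rewrite Rabs_Ropp in H; lra.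
Qed.

Lemma Derive_clamp l g V x : antideriv 0 l (fun y => g (clamp l y)) V ->
  0 < x < l -> Derive g x = V x.
Proof.
  intros [_ h] hx; apply is_derive_unique.
  apply is_derive_ext_loc with (fun y => g (clamp l y)); [|apply h; auto].
  apply filter_imp with (2 := clamp_locally l x hx); intros y ->; auto.
Qed.

(** Applied in time at x = 0 and x = l, where u vanishes for all t, to get boundary values of [ut]
    and [utt]. *)
Lemma deriv_on_zero a g g' : 0 < a -> deriv_on a g g' ->
  cts (fun x => g' (clamp a x)) -> (forall x, itv a x -> g x = 0) ->
  forall x, itv a x -> g' x = 0.
Proof.
  intros ha hg hg' h0 x hx.
  assert (hi : forall x, 0 < x < a -> g' (clamp a x) = 0).
  { intros y hy.
    destruct (deriv_on_clamp a g g' (Rlt_le _ _ ha) hg) as [_ hd].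
    rewrite <- (is_derive_unique _ _ _ (hd y hy)).
    rewrite (Derive_ext _ (fun _ => 0)); [apply Derive_const|].
    intros t; apply h0, clamp_itv; lra. }
  assert (h := cts_eq_closed a _ _ ha hg' (cts_const 0) hi x hx).
  cbv beta in h; rewrite clamp_id in h; auto.
Qed.

Definition kirchhoff (l : R) (alpha beta : R -> R) (ux : R -> R -> R) (t : R) : R :=
  alpha t + beta t * RInt (fun y => ux y t ^ 2) 0 l.

Lemma C1_on_bounds a g : 0 <= a -> C1_on a g -> exists B, 0 < B /\
  (forall x, itv a x -> Rabs (g x) <= B) /\
  (forall x y, itv a x -> itv a y -> Rabs (g x - g y) <= B * Rabs (x - y)).
Proof.
  intros ha [g' [hg hg']].
  destruct (continuous_on_bounded a g' ha hg') as [B [hB HB]].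
  pose proof (deriv_on_lipschitz a g g' B ha hg HB) as hlip.
  pose proof (Rabs_pos (g 0)) as h0.
  assert (0 <= B * a) by (apply Rmult_le_pos; lra).
  exists (B + Rabs (g 0) + B * a); repeat split; [lra| |].
  - intros x hx.
    assert (h := hlip x 0 hx ltac:(unfold itv; lra)).
    unfold itv in hx; rewrite Rminus_0_r, (Rabs_pos_eq x) in h by lra.
    pose proof (Rabs_triang_inv (g x) (g 0)).
    assert (B * x <= B * a) by (apply Rmult_le_compat_l; lra); lra.
  - intros x y hx hy; apply Rle_trans with (1 := hlip x y hx hy).
    apply Rmult_le_compat_r; [apply Rabs_pos|lra].
Qed.

(** * Exchange of x- and t-derivatives at the initial time *)

Section Mixed_derivatives.

Variables (l T : R) (u ux ut utt uttt uxt uxtt : R -> R -> R).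
Hypotheses (hl : 0 < l) (hT : 0 < T).
Hypotheses (hux : dx_on l T u ux) (hux_cont : cont2_on l T ux).
Hypotheses (hut : dt_on l T u ut) (hutt : dt_on l T ut utt)
  (huttt : dt_on l T utt uttt).
Hypotheses (hut_cont : cont2_on l T ut) (hutt_cont : cont2_on l T utt)
  (huttt_cont : cont2_on l T uttt).
Hypotheses (huxt : dt_on l T ux uxt) (huxtt : dt_on l T uxt uxtt)
  (huxtt_cont : cont2_on l T uxtt).
Hypothesis hbc : forall t, itv T t -> u 0 t = 0.

Let i0 : itv T 0. Proof. unfold itv; lra. Qed.
Let iT : itv T T. Proof. unfold itv; lra. Qed.
Let hl' : 0 <= l := Rlt_le _ _ hl.
Let hT' : 0 <= T := Rlt_le _ _ hT.

(** The quotients (ux(x, h) - ux(x, 0)) / h are continuous in x and, [uxtt] being bounded, lie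
    within B h of uxt(x, 0) uniformly in x. *)
Lemma uxt0_cts : cts (fun x => uxt (clamp l x) 0).
Proof.
  destruct (cont2_on_bounded l T uxtt hl' hT' huxtt_cont) as [B [hB HB]].
  apply uniform_limit_cts; intros eps he.
  destruct (small_step T B eps) as [h [hh1 [hh2 hh3]]]; auto.
  exists (fun x => (ux (clamp l x) h - ux (clamp l x) 0) / h); split.
  - assert (c1 := cont2_on_cts_x l T ux h hl' hT' hux_cont
      (conj (Rlt_le _ _ hh1) hh2)).
    assert (c2 := cont2_on_cts_x l T ux 0 hl' hT' hux_cont i0).
    cts_tac.
  - intros x; assert (hx := clamp_itv l x hl').
    pose proof (dt_taylor1 l T ux uxt uxtt B (clamp l x) h hT' huxt huxtt hx
      (conj (Rlt_le _ _ hh1) hh2) (fun t => HB _ t hx)) as H.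
    replace ((ux (clamp l x) h - ux (clamp l x) 0) / h - uxt (clamp l x) 0) with
      ((ux (clamp l x) h - ux (clamp l x) 0 - h * uxt (clamp l x) 0) / h)
      by (field; lra).
    unfold Rdiv; rewrite Rabs_mult, (Rabs_pos_eq (/ h))
      by (left; apply Rinv_0_lt_compat; auto).
    apply Rle_trans with (B * h ^ 2 * / h).
    + apply Rmult_le_compat_r; auto; left; apply Rinv_0_lt_compat; auto.
    + replace (B * h ^ 2 * / h) with (B * h) by (field; lra); lra.
Qed.

Let hx0 : itv l 0. Proof. unfold itv; lra. Qed.

Lemma ut0_boundary : ut 0 0 = 0.
Proof.
  apply (deriv_on_zero T (u 0) (ut 0)); auto.
  apply (cont2_on_cts_t l T); auto.
Qed.

(** [antideriv_of_approx] for the increments over [0, h], at scale s = h. The remainders are O(h^2),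
    for [ux] because [uxtt] is bounded and for [u] because [utt] is. The boundary condition at x = 0
    fixes the constant of integration. *)
Lemma ut0_antideriv :
  antideriv 0 l (fun x => ut (clamp l x) 0) (fun x => uxt (clamp l x) 0).
Proof.
  destruct (cont2_on_bounded l T uxtt hl' hT' huxtt_cont) as [B1 [hB1 HB1]].
  destruct (cont2_on_bounded l T utt hl' hT' hutt_cont) as [B2 [hB2 HB2]].
  apply antideriv_of_approx; auto.
  - apply (cont2_on_cts_x l T); auto.
  - apply uxt0_cts.
  - intros eps he.
    set (B := B1 + B2); assert (hB : 0 < B) by (unfold B; lra).
    destruct (small_step T B eps) as [h [hh1 [hh2 hh3]]]; auto.
    assert (ih : itv T h) by (unfold itv; lra).
    exists (fun x => u (clamp l x) h - u (clamp l x) 0),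
      (fun x => ux (clamp l x) h - ux (clamp l x) 0), h.
    assert (hsm : forall b, b <= B -> b * h ^ 2 <= eps * h).
    { intros b hb; replace (b * h ^ 2) with (b * h * h) by ring.
      apply Rmult_le_compat_r; [lra|].
      apply Rle_trans with (2 := hh3), Rmult_le_compat_r; lra. }
    split; [auto|split; [|split; [|split]]].
    + apply antideriv_minus; apply (dx_on_antideriv l T); auto.
    + rewrite clamp_id by auto; rewrite !hbc by auto; ring.
    + intros x hx; rewrite !(clamp_id l) by auto.
      eapply Rle_trans; [|apply (hsm B1); unfold B; lra].
      apply (dt_taylor1 l T ux uxt uxtt); auto.
    + intros x hx; rewrite !(clamp_id l) by auto.
      eapply Rle_trans; [|apply (hsm B2); unfold B; lra].
      apply (dt_taylor1 l T u ut utt); auto.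
Qed.

(** The same argument one order higher: after subtracting the linear term the increment is h^2 / 2
    times the second derivative, which sets the scale. The remainder of u is controlled by [uttt];
    that of [ux] by the modulus of uniform continuity of [uxtt] along t = 0. *)
Lemma utt0_antideriv :
  antideriv 0 l (fun x => utt (clamp l x) 0) (fun x => uxtt (clamp l x) 0).
Proof.
  destruct (cont2_on_bounded l T uttt hl' hT' huttt_cont) as [B [hB HB]].
  assert (hc := cont2_on_clamp l T uxtt hl' hT' huxtt_cont).
  apply antideriv_of_approx; auto; try (apply (cont2_on_cts_x l T); auto).
  intros eps he.
  destruct (uniform_continuity_2d_1d (clamp2 l T uxtt) 0 l 0
    (fun x _ => hc x 0) (mkposreal (eps / 2) ltac:(lra))) as [d hd].
  assert (hd0 := cond_pos d); simpl in hd.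
  destruct (small_step (Rmin T d) B (eps / 2)) as [h [hh1 [hhm hh4]]]; [|lra|lra|].
  { apply Rmin_glb_lt; lra. }
  pose proof (Rmin_l T d); pose proof (Rmin_r T d).
  assert (ih : itv T h) by (unfold itv; lra).
  exists (fun x => u (clamp l x) h - u (clamp l x) 0 - h * ut (clamp l x) 0),
    (fun x => ux (clamp l x) h - ux (clamp l x) 0 - h * uxt (clamp l x) 0),
    (h ^ 2 / 2).
  assert (hh5 : 0 < h ^ 2) by (apply pow_lt; auto).
  split; [lra|]; split; [|split; [|split]].
  - apply antideriv_minus.
    + apply antideriv_minus; apply (dx_on_antideriv l T); auto.
    + apply antideriv_scal, ut0_antideriv.
  - rewrite clamp_id by auto; rewrite !hbc, ut0_boundary by auto; ring.
  - intros x hx; rewrite !(clamp_id l) by auto.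
    replace (eps * (h ^ 2 / 2)) with (eps / 2 * h ^ 2) by field.
    apply (dt_taylor2 l T ux uxt uxtt); auto.
    intros t ht; left.
    specialize (hd x 0 x t hx ltac:(lra) hx ltac:(lra)).
    unfold clamp2 in hd; rewrite !clamp_id in hd by (auto; unfold itv; lra).
    apply hd; rewrite Rminus_diag, Rabs_R0; auto.
  - intros x hx; rewrite !(clamp_id l) by auto.
    replace (eps * (h ^ 2 / 2)) with (eps / 2 * h ^ 2) by field.
    apply (dt_taylor2 l T u ut utt); auto.
    intros t ht.
    assert (it : itv T t) by (unfold itv; lra).
    apply Rle_trans with (1 := dt_on_lipschitz l T utt uttt B hT' huttt HB
      x t 0 hx it i0).
    rewrite Rminus_0_r, Rabs_pos_eq by lra.
    apply Rle_trans with (2 := hh4), Rmult_le_compat_l; lra.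
Qed.

Lemma ux_lipschitz : exists B, 0 < B /\ forall x t s, itv l x -> itv T t ->
  itv T s -> Rabs (ux x t - ux x s) <= B * Rabs (t - s).
Proof.
  destruct (cont2_on_bounded l T uxtt hl' hT' huxtt_cont) as [B [hB HB]].
  destruct (cont2_on_bounded l T ux hl' hT' hux_cont) as [B1 [hB1 HB1]].
  assert (hBT : 0 <= B * T) by (apply Rmult_le_pos; lra).
  assert (hB1T : 0 < B1 / T) by (apply Rdiv_lt_0_compat; lra).
  (* A Taylor expansion over all of [0, T] bounds uxt(x, 0) by 2 B1 / T + B T, and [uxt] varies in t
     by at most another B T. *)
  exists (2 * (B1 / T) + 2 * (B * T)); split; [lra|].
  apply (dt_on_lipschitz l T ux uxt); auto; intros x t hx ht.
  pose proof (dt_taylor1 l T ux uxt uxtt B x T hT' huxt huxtt hx iT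
    (fun t => HB _ t hx)) as H.
  pose proof (dt_on_lipschitz l T uxt uxtt B hT' huxtt HB x t 0 hx ht i0) as H1.
  assert (h0 := HB1 x 0 hx i0); assert (hTT := HB1 x T hx iT).
  unfold itv in ht; rewrite Rminus_0_r, (Rabs_pos_eq t) in H1 by lra.
  assert (B * t <= B * T) by (apply Rmult_le_compat_l; lra).
  assert (H2 : T * Rabs (uxt x 0) <= T * (2 * (B1 / T) + B * T)).
  { replace (T * (2 * (B1 / T) + B * T)) with (2 * B1 + B * T ^ 2)
      by (field; lra).
    rewrite <- (Rabs_pos_eq T hT') at 1; rewrite <- Rabs_mult.
    revert H h0 hTT; unfold Rabs; repeat destruct Rcase_abs; lra. }
  apply Rmult_le_reg_l in H2; auto.
  pose proof (Rabs_triang_inv (uxt x t) (uxt x 0)); lra.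
Qed.

End Mixed_derivatives.

(** * Bounds for the nonlocal coefficient of the exact solution *)

Lemma kirchhoff_bounds l T alpha beta ux : 0 < l -> 0 < T ->
  C1_on T alpha -> C1_on T beta -> cont2_on l T ux ->
  (exists B, 0 < B /\ forall x t s, itv l x -> itv T t ->
    itv T s -> Rabs (ux x t - ux x s) <= B * Rabs (t - s)) ->
  exists B, 0 < B /\
    (forall t, itv T t -> Rabs (kirchhoff l alpha beta ux t) <= B) /\
    (forall t s, itv T t -> itv T s ->
      Rabs (kirchhoff l alpha beta ux t - kirchhoff l alpha beta ux s)
        <= B * Rabs (t - s)).
Proof.
  intros hl hT halpha hbeta hux [L [hL HL]].
  destruct (C1_on_bounds T alpha) as [A [hA [A1 A2]]]; [lra|auto|].
  destruct (C1_on_bounds T beta) as [B [hB [B1 B2]]]; [lra|auto|].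
  destruct (cont2_on_bounded l T ux) as [M [hM HM]]; [lra|lra|auto|].
  set (S := fun t => RInt (fun y => ux y t ^ 2) 0 l).
  assert (hS : forall t, S t = RInt (fun y => ux (clamp l y) t ^ 2) 0 l).
  { intros t; apply RIntR_ext; [lra|]; intros x hx.
    rewrite clamp_id; auto; unfold itv; lra. }
  assert (hc : forall t, itv T t -> cts (fun x => ux (clamp l x) t)).
  { intros t ht; apply (cont2_on_cts_x l T); auto; lra. }
  assert (hSb : forall t, itv T t -> Rabs (S t) <= l * M ^ 2).
  { intros t ht; specialize (hc t ht).
    rewrite Rabs_pos_eq by (rewrite hS; apply RInt_sqr_pos; [lra|auto]).
    rewrite hS; apply RInt_le_const; [lra|cts_tac|].
    intros x hx; rewrite clamp_id by (unfold itv; lra).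
    apply pow_maj_Rabs, HM; auto; unfold itv; lra. }
  (* [RInt_le_const] bounds from above only; [hSl] then exchanges t and s to reach the absolute
     value. *)
  assert (hSd : forall t s, itv T t -> itv T s ->
    S t - S s <= l * (2 * M * L * Rabs (t - s))).
  { intros t s ht hs; assert (ct := hc t ht); assert (cs := hc s hs).
    rewrite !hS, <- RIntR_minus by cts_tac.
    apply RInt_le_const; [lra|cts_tac|]; intros x hx.
    assert (ix : itv l x) by (unfold itv; lra).
    rewrite clamp_id by auto.
    replace (ux x t ^ 2 - ux x s ^ 2) with
      ((ux x t + ux x s) * (ux x t - ux x s)) by ring.
    apply Rle_trans with (1 := RRle_abs _); rewrite Rabs_mult.
    replace (2 * M * L * Rabs (t - s)) with (2 * M * (L * Rabs (t - s))) by ring.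
    apply Rmult_le_compat; try apply Rabs_pos; auto.
    apply Rle_trans with (1 := Rabs_triang _ _).
    pose proof (HM x t ix ht); pose proof (HM x s ix hs); lra. }
  assert (hSl : forall t s, itv T t -> itv T s ->
    Rabs (S t - S s) <= l * (2 * M * L * Rabs (t - s))).
  { intros t s ht hs; apply Rabs_le; split; [|apply hSd; auto].
    assert (h := hSd s t hs ht); rewrite Rabs_minus_sym in h; lra. }
  assert (hp1 : 0 <= l * M ^ 2).
  { apply Rmult_le_pos; [lra|apply pow_le; lra]. }
  assert (hp2 : 0 <= B * (l * M ^ 2)) by (apply Rmult_le_pos; lra).
  assert (hp3 : 0 <= B * (l * (2 * M * L))) by (repeat apply Rmult_le_pos; lra).
  exists (A + B * (l * M ^ 2) + B * (l * (2 * M * L))); split; [lra|].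
  unfold kirchhoff; fold (S 0); split.
  - intros t ht; apply Rle_trans with (1 := Rabs_triang _ _).
    rewrite Rabs_mult.
    assert (Rabs (beta t) * Rabs (S t) <= B * (l * M ^ 2)).
    { apply Rmult_le_compat; try apply Rabs_pos; auto. }
    specialize (A1 t ht); unfold S in *; lra.
  - intros t s ht hs; change (Rabs (alpha t + beta t * S t
      - (alpha s + beta s * S s)) <=
      (A + B * (l * M ^ 2) + B * (l * (2 * M * L))) * Rabs (t - s)).
    replace (alpha t + beta t * S t - (alpha s + beta s * S s)) with
      (alpha t - alpha s + ((beta t - beta s) * S t + beta s * (S t - S s)))
      by ring.
    apply Rle_trans with (1 := Rabs_triang _ _).
    pose proof (Rabs_triang ((beta t - beta s) * S t) (beta s * (S t - S s))) as h.
    rewrite !Rabs_mult in h.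
    assert (h1 : Rabs (beta t - beta s) * Rabs (S t)
      <= B * Rabs (t - s) * (l * M ^ 2))
      by (apply Rmult_le_compat; try apply Rabs_pos; auto).
    assert (h2 : Rabs (beta s) * Rabs (S t - S s)
      <= B * (l * (2 * M * L * Rabs (t - s))))
      by (apply Rmult_le_compat; try apply Rabs_pos; auto).
    specialize (A2 t s ht hs); lra.
Qed.

(** * The scheme *)

(** The regularity that survives the recursion level by level: one derivative, continuous up to the
    ends, and the Dirichlet conditions. V stands for the derivative inside and is continuous on the
    whole line, so its integrals raise no questions of existence. *)
Definition regular (l : R) (F V : R -> R) : Prop :=
  antideriv 0 l (fun x => F (clamp l x)) V /\ cts V /\ F 0 = 0 /\ F l = 0.

Lemma cts_ext f g : (forall x, f x = g x) -> cts f -> cts g.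
Proof. intros h hf x; apply continuous_ext with f; auto. Qed.

Lemma antideriv_ext_fun a b F G f : (forall x, F x = G x) ->
  antideriv a b F f -> antideriv a b G f.
Proof.
  intros h [h1 h2]; split; [apply (cts_ext F); auto|].
  intros x hx; apply is_derive_ext with F; auto.
Qed.

Lemma regular_ext l F G V : 0 <= l -> (forall x, itv l x -> F x = G x) ->
  regular l F V -> regular l G V.
Proof.
  intros hl h [h1 [h2 [h3 h4]]].
  split; [|split; [auto|split]].
  - apply (antideriv_ext_fun 0 l (fun x => F (clamp l x))); auto.
    intros x; apply h, clamp_itv, hl.
  - rewrite <- h; auto; unfold itv; lra.
  - rewrite <- h; auto; unfold itv; lra.
Qed.

Lemma regular_minus l F V G W : regular l F V -> regular l G W ->
  regular l (fun x => F x - G x) (fun x => V x - W x).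
Proof.
  intros [h1 [h2 [h3 h4]]] [k1 [k2 [k3 k4]]]; split; [|split; [|split]].
  - apply (antideriv_minus 0 l (fun x => F (clamp l x)) V); auto.
  - cts_tac.
  - rewrite h3, k3; ring.
  - rewrite h4, k4; ring.
Qed.

Lemma regular_RInt_Derive l F V : 0 <= l -> regular l F V ->
  RInt (fun x => Derive F x ^ 2) 0 l = RInt (fun x => V x ^ 2) 0 l.
Proof.
  intros hl [h _]; apply RIntR_ext; auto; intros x hx.
  rewrite (Derive_clamp l F V x); auto.
Qed.

Lemma lipschitz_clamp_cts a g B : 0 <= a -> 0 < B ->
  (forall x y, itv a x -> itv a y -> Rabs (g x - g y) <= B * Rabs (x - y)) ->
  cts (fun x => g (clamp a x)).
Proof.
  intros ha hB h; apply eps_cts; intros x eps he.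
  exists (eps / B); split; [apply Rdiv_lt_0_compat; lra|]; intros y hy.
  apply Rle_lt_trans with (1 := h _ _ (clamp_itv a y ha) (clamp_itv a x ha)).
  apply (Rmult_lt_compat_l B) in hy; auto.
  replace (B * (eps / B)) with eps in hy by (field; lra).
  pose proof (Rmult_le_compat_l B _ _ (Rlt_le _ _ hB) (clamp_lip a y x)); lra.
Qed.

Lemma antideriv_unique a b F f g x : antideriv a b F f -> antideriv a b F g ->
  a < x < b -> f x = g x.
Proof.
  intros [_ h1] [_ h2] hx.
  rewrite <- (is_derive_unique _ _ _ (h1 x hx)).
  apply is_derive_unique, h2, hx.
Qed.

(** * The exact solution: initial identities and uniform bounds *)

Section Convergence.

Variables (l T c0 c1 : R) (alpha beta : R -> R) (f : R -> R -> R)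
  (psi0 dpsi0 ddpsi0 psi1 : R -> R)
  (u ux uxx ut utt uttt uxt uxtt uxxt : R -> R -> R).
Hypotheses (hl : 0 < l) (hT : 0 < T)
  (halpha : C1_on T alpha) (hbeta : C1_on T beta)
  (hc0 : 0 < c0) (halpha_lb : forall t, itv T t -> c0 <= alpha t)
  (hc1 : 0 < c1) (hbeta_lb : forall t, itv T t -> c1 <= beta t)
  (hf : cont2_on l T f)
  (hsol : classical_solution l T alpha beta f psi0 psi1 u ux uxx ut utt)
  (hpsi0' : deriv_on l psi0 dpsi0) (hpsi0'' : deriv_on l dpsi0 ddpsi0)
  (hpsi0''_cont : continuous_on (itv l) ddpsi0)
  (huxt : dt_on l T ux uxt) (huxtt : dt_on l T uxt uxtt)
  (huxtt_cont : cont2_on l T uxtt)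
  (huttt : dt_on l T utt uttt) (huttt_cont : cont2_on l T uttt)
  (huttt_lip : lipschitz_t l T uttt)
  (huxxt : dt_on l T uxx uxxt) (huxxt_lip : lipschitz_t l T uxxt).

Let hl' : 0 <= l := Rlt_le _ _ hl.
Let hT' : 0 <= T := Rlt_le _ _ hT.
Let i0 : itv T 0. Proof. unfold itv; lra. Qed.
Let ix0 : itv l 0. Proof. unfold itv; lra. Qed.
Let ixl : itv l l. Proof. unfold itv; lra. Qed.
Let hux := sol_ux _ _ _ _ _ _ _ _ _ _ _ _ hsol.
Let huxx := sol_uxx _ _ _ _ _ _ _ _ _ _ _ _ hsol.
Let hut := sol_ut _ _ _ _ _ _ _ _ _ _ _ _ hsol.
Let hutt := sol_utt _ _ _ _ _ _ _ _ _ _ _ _ hsol.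
Let hux_cont := sol_ux_cont _ _ _ _ _ _ _ _ _ _ _ _ hsol.
Let huxx_cont := sol_uxx_cont _ _ _ _ _ _ _ _ _ _ _ _ hsol.
Let hut_cont := sol_ut_cont _ _ _ _ _ _ _ _ _ _ _ _ hsol.
Let hutt_cont := sol_utt_cont _ _ _ _ _ _ _ _ _ _ _ _ hsol.
Let heq := sol_eq _ _ _ _ _ _ _ _ _ _ _ _ hsol.
Let hinit0 := sol_init0 _ _ _ _ _ _ _ _ _ _ _ _ hsol.
Let hinit1 := sol_init1 _ _ _ _ _ _ _ _ _ _ _ _ hsol.
Let hbc := sol_bc _ _ _ _ _ _ _ _ _ _ _ _ hsol.

Let qex := kirchhoff l alpha beta ux.

Lemma ux_lip : exists B, 0 < B /\ forall x t s, itv l x -> itv T t ->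
  itv T s -> Rabs (ux x t - ux x s) <= B * Rabs (t - s).
Proof. apply (ux_lipschitz l T ux uxt uxtt); auto. Qed.

Lemma exact_regular t : itv T t ->
  regular l (fun x => u x t) (fun x => ux (clamp l x) t).
Proof.
  intros ht; split; [|split; [|apply hbc, ht]].
  - apply (dx_on_antideriv l T); auto.
  - apply (cont2_on_cts_x l T); auto.
Qed.

(** Both sides are second derivatives of the same initial function, named by different hypotheses.
    Derivatives are unique inside and continuous up to the ends; the argument is run once for each
    order. *)
Lemma uxx0_eq x : itv l x -> uxx x 0 = ddpsi0 x.
Proof.
  assert (h1 : forall x, itv l x -> ux x 0 = dpsi0 x).
  { assert (c1' := cont2_on_cts_x l T ux 0 hl' hT' hux_cont i0).
    assert (a2 := deriv_on_clamp l dpsi0 ddpsi0 hl' hpsi0'').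
    intros y hy.
    rewrite <- (clamp_id l y) by auto.
    apply (cts_eq_closed l (fun y => ux (clamp l y) 0)
      (fun y => dpsi0 (clamp l y)) hl c1' (proj1 a2)); auto.
    intros z hz.
    apply (antideriv_unique 0 l (fun x => psi0 (clamp l x))
      (fun y => ux (clamp l y) 0) (fun y => dpsi0 (clamp l y))); auto.
    - apply (antideriv_ext_fun 0 l (fun x => u (clamp l x) 0)).
      + intros w; apply hinit0, clamp_itv, hl'.
      + apply (dx_on_antideriv l T); auto.
    - apply deriv_on_clamp; auto. }
  intros hx; rewrite <- (clamp_id l x) by auto.
  apply (cts_eq_closed l (fun y => uxx (clamp l y) 0)
    (fun y => ddpsi0 (clamp l y)) hl); auto.
  - apply (cont2_on_cts_x l T); auto.
  - apply continuous_on_clamp; auto.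
  - intros z hz.
    apply (antideriv_unique 0 l (fun x => dpsi0 (clamp l x))
      (fun y => uxx (clamp l y) 0) (fun y => ddpsi0 (clamp l y))); auto.
    + apply (antideriv_ext_fun 0 l (fun x => ux (clamp l x) 0)).
      * intros w; apply h1, clamp_itv, hl'.
      * apply (dx_on_antideriv l T); auto.
    + apply deriv_on_clamp; auto.
Qed.

(** [sol_eq] covers 0 < x < l and t > 0. Continuity in time, including that of the coefficient,
    extends it to t = 0; continuity in space then reaches x = 0 and x = l. *)
Lemma equation_at_0 x : itv l x -> utt x 0 = f x 0 + qex 0 * ddpsi0 x.
Proof.
  destruct (kirchhoff_bounds l T alpha beta ux hl hT halpha hbeta hux_cont ux_lip)
    as [B [hB [_ hBl]]].
  assert (cq := lipschitz_clamp_cts T qex B hT' hB hBl).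
  assert (hi : forall x, 0 < x < l -> utt x 0 = f x 0 + qex 0 * uxx x 0).
  { intros y hy; assert (iy : itv l y) by (unfold itv; lra).
    assert (e1 := cont2_on_cts_t l T utt y hl' hT' hutt_cont iy).
    assert (e2 := cont2_on_cts_t l T f y hl' hT' hf iy).
    assert (e3 := cont2_on_cts_t l T uxx y hl' hT' huxx_cont iy).
    assert (h : utt y (clamp T 0)
      = f y (clamp T 0) + qex (clamp T 0) * uxx y (clamp T 0)).
    { apply (cts_eq_closed T (fun t => utt y (clamp T t))
        (fun t => f y (clamp T t) + qex (clamp T t) * uxx y (clamp T t)) hT e1);
        auto; [cts_tac|].
      intros t ht; rewrite clamp_id by (unfold itv; lra).
      rewrite <- heq by lra; unfold qex, kirchhoff; ring. }
    rewrite clamp_id in h by auto; exact h. }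
  intros hx; rewrite <- uxx0_eq by auto.
  assert (e1 := cont2_on_cts_x l T utt 0 hl' hT' hutt_cont i0).
  assert (e2 := cont2_on_cts_x l T f 0 hl' hT' hf i0).
  assert (e3 := cont2_on_cts_x l T uxx 0 hl' hT' huxx_cont i0).
  rewrite <- (clamp_id l x) by auto.
  apply (cts_eq_closed l (fun y => utt (clamp l y) 0)
    (fun y => f (clamp l y) 0 + qex 0 * uxx (clamp l y) 0) hl e1); auto;
    [cts_tac|].
  intros y hy; rewrite clamp_id by (unfold itv; lra); apply hi, hy.
Qed.

(** One constant, fixed before n and U, serves every estimate. The last two remainders differ in
    order: [D 0] divides the error by tau and so needs O(h^3), whereas [N 1] needs O(h^2), which
    boundedness of [uxtt] provides. *)
Lemma exact_bounds : exists B, 1 <= B /\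
  (forall x t, itv l x -> itv T t -> Rabs (ux x t) <= B) /\
  (forall x t, itv l x -> itv T t -> Rabs (uxx x t) <= B) /\
  (forall t, itv T t -> Rabs (qex t) <= B) /\
  (forall t s, itv T t -> itv T s -> Rabs (qex t - qex s) <= B * Rabs (t - s)) /\
  (forall t, itv T t -> 0 <= beta t <= B) /\
  (forall x t h, itv l x -> 0 <= h -> 0 <= t - h -> t + h <= T ->
    Rabs (u x (t + h) - 2 * u x t + u x (t - h) - h ^ 2 * utt x t) <= B * h ^ 4) /\
  (forall x t h, itv l x -> 0 <= h -> 0 <= t - h -> t + h <= T ->
    Rabs (uxx x (t + h) - 2 * uxx x t + uxx x (t - h)) <= B * h ^ 2) /\
  (forall x h, itv l x -> itv T h ->
    Rabs (u x h - u x 0 - h * ut x 0 - h ^ 2 / 2 * utt x 0) <= B * h ^ 3) /\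
  (forall x h, itv l x -> itv T h ->
    Rabs (ux x h - ux x 0 - h * uxt x 0 - h ^ 2 / 2 * uxtt x 0) <= B * h ^ 2).
Proof.
  destruct (cont2_on_bounded l T ux hl' hT' hux_cont) as [B1 [p1 H1]].
  destruct (cont2_on_bounded l T uxx hl' hT' huxx_cont) as [B2 [p2 H2]].
  destruct (kirchhoff_bounds l T alpha beta ux hl hT halpha hbeta hux_cont ux_lip)
    as [B3 [p3 [H3 H4]]].
  destruct (C1_on_bounds T beta hT' hbeta) as [B5 [p5 [H5 _]]].
  destruct (dt_second_difference4 l T u ut utt uttt hT' hut hutt huttt huttt_lip)
    as [B6 [p6 H6]].
  destruct (dt_second_difference2 l T uxx uxxt hT' huxxt huxxt_lip)
    as [B7 [p7 H7]].
  destruct (cont2_on_bounded l T uttt hl' hT' huttt_cont) as [B8 [p8 H8]].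
  destruct (cont2_on_bounded l T uxtt hl' hT' huxtt_cont) as [B9 [p9 H9]].
  set (B := 1 + B1 + B2 + B3 + B5 + B6 + B7 + B8 + 2 * B9).
  assert (up : forall b y z, b <= B -> 0 <= y -> z <= b * y -> z <= B * y).
  { intros b y z hb hy hz; apply Rle_trans with (1 := hz).
    apply Rmult_le_compat_r; auto. }
  exists B; split; [unfold B; lra|].
  split; [intros; apply Rle_trans with B1; [auto|unfold B; lra]|].
  split; [intros; apply Rle_trans with B2; [auto|unfold B; lra]|].
  split; [intros; apply Rle_trans with B3; [apply H3; auto|unfold B; lra]|].
  split; [intros; apply (up B3); [unfold B; lra|apply Rabs_pos|apply H4; auto]|].
  split.
  { intros t ht; assert (h := H5 t ht); assert (h' := hbeta_lb t ht).
    pose proof (RRle_abs (beta t)); unfold B; lra. }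
  split; [intros; apply (up B6); [unfold B; lra|apply pow_le; auto|auto]|].
  split; [intros; apply (up B7); [unfold B; lra|apply pow_le; auto|auto]|].
  split.
  - intros x h hx hh; apply (up B8); [unfold B; lra|apply pow_le, hh|].
    replace (B8 * h ^ 3) with (B8 * h * h ^ 2) by ring.
    apply (dt_taylor2 l T u ut utt); auto.
    intros t ht.
    assert (it : itv T t) by (unfold itv in *; lra).
    apply Rle_trans with (1 := dt_on_lipschitz l T utt uttt B8 hT' huttt H8
      x t 0 hx it i0).
    rewrite Rminus_0_r, Rabs_pos_eq by lra; apply Rmult_le_compat_l; lra.
  - intros x h hx hh; apply (up (2 * B9)); [unfold B; lra|apply pow_le, hh|].
    apply (dt_taylor2 l T ux uxt uxtt); auto.
    intros t ht.
    assert (it : itv T t) by (unfold itv in *; lra).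
    pose proof (H9 x t hx it) as a1; pose proof (H9 x 0 hx i0) as a2.
    revert a1 a2; unfold Rabs; repeat destruct Rcase_abs; lra.
Qed.

(** * Regularity of the approximate solutions *)

Section Scheme.

Variables (n : nat) (U : nat -> R -> R).
Hypothesis hn : (0 < n)%nat.
Hypothesis hU : scheme l T alpha beta f psi0 ddpsi0 psi1 n U.

Let tau := step T n.
Let q := qcoef l T alpha beta n U.
Let z := fun (k : nat) (x : R) => u x (node T n k) - U k x.

Lemma step_pos : 0 < tau.
Proof. apply Rdiv_lt_0_compat; auto; apply lt_0_INR; auto. Qed.

Lemma node_S k : node T n (S k) = node T n k + tau.
Proof. unfold node; rewrite S_INR; unfold tau; ring. Qed.

Lemma node_0 : node T n 0 = 0.
Proof. unfold node; simpl; ring. Qed.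

Lemma node_n : node T n n = T.
Proof. unfold node, step; field; apply not_0_INR; lia. Qed.

Lemma node_itv k : (k <= n)%nat -> itv T (node T n k).
Proof.
  intros hk; assert (h := step_pos); unfold tau in h; split.
  - apply Rmult_le_pos; [apply pos_INR|lra].
  - apply Rle_trans with (node T n n); [|right; apply node_n].
    apply Rmult_le_compat_r; [lra|apply le_INR, hk].
Qed.

(** Regularity turns the integral in [q k] into that of a continuous square, hence a nonnegative
    number. *)
Lemma q_lower_bound k V : (k <= n)%nat -> regular l (U k) V -> c0 <= q k.
Proof.
  intros hk hV; unfold q, qcoef.
  rewrite (regular_RInt_Derive l (U k) V) by auto.
  destruct hV as [_ [hV _]].
  assert (h := RInt_sqr_pos V l hl' hV).
  pose proof (halpha_lb _ (node_itv k hk)); pose proof (hbeta_lb _ (node_itv k hk)).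
  assert (0 <= beta (node T n k) * RInt (fun x => V x ^ 2) 0 l)
    by (apply Rmult_le_pos; lra); lra.
Qed.

Lemma U0_regular : regular l (U 0%nat) (fun x => ux (clamp l x) 0).
Proof.
  apply (regular_ext l (fun x => u x 0)); auto; [|apply exact_regular; auto].
  intros x hx; rewrite (scheme_0 _ _ _ _ _ _ _ _ _ _ hU) by auto; auto.
Qed.

Lemma q0_eq : q 0%nat = qex 0.
Proof.
  unfold q, qcoef, qex, kirchhoff; rewrite node_0.
  rewrite (regular_RInt_Derive l _ _ hl' U0_regular); do 2 f_equal.
  apply RIntR_ext; auto; intros x hx; rewrite clamp_id; auto; unfold itv; lra.
Qed.

(** By the equation at t = 0, psi2 equals utt(x, 0); the starting value is therefore the quadratic
    Taylor polynomial of u in time. *)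
Lemma U1_eq x : itv l x ->
  U 1%nat x = u x 0 + tau * ut x 0 + tau ^ 2 / 2 * utt x 0.
Proof.
  intros hx; rewrite (scheme_1 _ _ _ _ _ _ _ _ _ _ hU) by auto.
  fold q; rewrite q0_eq, <- equation_at_0, hinit0, hinit1 by auto; auto.
Qed.

(** Supplies the boundary values of level 1, since [scheme_bc] starts at level 2. *)
Lemma utt0_bc x : x = 0 \/ x = l -> u x 0 + tau * ut x 0 + tau ^ 2 / 2 * utt x 0 = 0.
Proof.
  intros hx.
  assert (ix : itv l x) by (destruct hx; subst; auto).
  assert (h0 : forall t, itv T t -> u x t = 0).
  { intros t ht; destruct (hbc t ht); destruct hx; subst; auto. }
  assert (h1 : forall t, itv T t -> ut x t = 0).
  { apply (deriv_on_zero T (u x)); auto; apply (cont2_on_cts_t l T); auto. }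
  assert (h2 : forall t, itv T t -> utt x t = 0).
  { apply (deriv_on_zero T (ut x)); auto; apply (cont2_on_cts_t l T); auto. }
  rewrite h0, h1, h2 by auto; ring.
Qed.

Lemma U1_regular : regular l (U 1%nat) (fun x => ux (clamp l x) 0
  + tau * uxt (clamp l x) 0 + tau ^ 2 / 2 * uxtt (clamp l x) 0).
Proof.
  assert (hbc0 : forall t, itv T t -> u 0 t = 0) by (intros; apply hbc; auto).
  apply (regular_ext l
    (fun x => u x 0 + tau * ut x 0 + tau ^ 2 / 2 * utt x 0)); auto.
  { intros x hx; symmetry; apply U1_eq, hx. }
  split; [|split; [|split; apply utt0_bc; auto]].
  - apply (antideriv_plus 0 l (fun x => u (clamp l x) 0 + tau * ut (clamp l x) 0)
      (fun x => ux (clamp l x) 0 + tau * uxt (clamp l x) 0)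
      (fun x => tau ^ 2 / 2 * utt (clamp l x) 0)
      (fun x => tau ^ 2 / 2 * uxtt (clamp l x) 0)).
    + apply (antideriv_plus 0 l (fun x => u (clamp l x) 0)
        (fun x => ux (clamp l x) 0) (fun x => tau * ut (clamp l x) 0)
        (fun x => tau * uxt (clamp l x) 0)).
      * apply (dx_on_antideriv l T); auto.
      * apply (antideriv_scal 0 l tau (fun x => ut (clamp l x) 0)
          (fun x => uxt (clamp l x) 0)).
        apply (ut0_antideriv l T u ux ut utt uxt uxtt); auto.
    + apply (antideriv_scal 0 l (tau ^ 2 / 2) (fun x => utt (clamp l x) 0)
        (fun x => uxtt (clamp l x) 0)).
      apply (utt0_antideriv l T u ux ut utt uttt uxt uxtt); auto.
  - assert (e1 := cont2_on_cts_x l T ux 0 hl' hT' hux_cont i0).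
    assert (e2 := cont2_on_cts_x l T uxtt 0 hl' hT' huxtt_cont i0).
    assert (e3 : cts (fun x => uxt (clamp l x) 0))
      by (apply (uxt0_cts l T ux uxt uxtt); auto).
    cts_tac.
Qed.

(* w'' is continuous because the scheme expresses it through U and f. *)
Lemma scheme_step_regular k V0 V1 : (S (S k) <= n)%nat ->
  regular l (U k) V0 -> regular l (U (S k)) V1 ->
  exists w' w'' : R -> R, cts w' /\ cts w'' /\ antideriv 0 l w' w'' /\
    regular l (U (S (S k))) (fun x => w' x - V0 x) /\
    forall x, itv l x ->
      (U (S (S k)) x - 2 * U (S k) x + U k x) / tau ^ 2
        - 1 / 2 * q (S k) * w'' x = f x (node T n (S k)).
Proof.
  intros hk h0 h1.
  destruct (scheme_step _ _ _ _ _ _ _ _ _ _ hU (S k) ltac:(lia))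
    as [w' [w'' [hw [hw' hw'']]]].
  destruct (scheme_bc _ _ _ _ _ _ _ _ _ _ hU (S k) ltac:(lia)) as [b0 bl].
  replace (S k + 1)%nat with (S (S k)) in * by lia.
  replace (S k - 1)%nat with k in * by lia.
  fold tau q in hw''; fold q in hw''.
  assert (hq := q_lower_bound (S k) V1 ltac:(lia) h1).
  assert (ht := step_pos).
  assert (a1 := deriv_on_clamp l _ _ hl' hw).
  assert (a2 := deriv_on_clamp l _ _ hl' hw').
  exists (fun x => w' (clamp l x)), (fun x => w'' (clamp l x)).
  destruct h0 as [r0 [r1 [r2 r3]]], h1 as [s0 [s1 [s2 s3]]].
  assert (cw := proj1 a1); assert (c_1 := proj1 s0); assert (c_0 := proj1 r0).
  assert (cf := cont2_on_cts_x l T f (node T n (S k)) hl' hT' hf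
    (node_itv (S k) ltac:(lia))).
  split; [apply a2|split; [|split; [exact a2|split]]].
  - apply (cts_ext (fun x => 2 / q (S k) *
      ((U (S (S k)) (clamp l x) + U k (clamp l x) - 2 * U (S k) (clamp l x))
        / tau ^ 2 - f (clamp l x) (node T n (S k))))).
    + intros x; rewrite <- (hw'' (clamp l x)) by (apply clamp_itv; auto).
      field; split; lra.
    + cts_tac.
  - split; [|split; [|auto]].
    (* The scheme differentiates only the sum of levels k + 2 and k; level k is already regular and
       is subtracted. *)
    + apply (antideriv_ext_fun 0 l (fun x => (U (S (S k)) (clamp l x)
        + U k (clamp l x)) - U k (clamp l x))); [intros; ring|].
      apply antideriv_minus; auto.
    + apply cts_minus; [apply a2|auto].
  - intros x hx; rewrite clamp_id by auto; apply hw'', hx.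
Qed.

(** A step consumes two earlier levels, so the induction carries consecutive pairs. *)
Lemma scheme_regular k : (k <= n)%nat -> exists V, regular l (U k) V.
Proof.
  assert (H : ((k <= n)%nat -> exists V, regular l (U k) V) /\
    ((S k <= n)%nat -> exists V, regular l (U (S k)) V)); [|apply H].
  induction k as [|j [IH1 IH2]]; split.
  - intros _; eexists; apply U0_regular.
  - intros _; eexists; apply U1_regular.
  - exact IH2.
  - intros hj; destruct (IH1 ltac:(lia)) as [V0 h0].
    destruct (IH2 ltac:(lia)) as [V1 h1].
    destruct (scheme_step_regular j V0 V1 hj h0 h1)
      as [w' [w'' [_ [_ [_ [h _]]]]]].
    eexists; apply h.
Qed.

Lemma z_regular k V : (k <= n)%nat -> regular l (U k) V ->
  regular l (z k) (fun x => ux (clamp l x) (node T n k) - V x).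
Proof.
  intros hk hV.
  apply (regular_minus l (fun x => u x (node T n k))
    (fun x => ux (clamp l x) (node T n k))); auto.
  apply exact_regular, node_itv, hk.
Qed.

Let N k := RInt (fun x => Derive (z k) x ^ 2) 0 l.
Let D k := RInt (fun x => ((z (S k) x - z k x) / tau) ^ 2) 0 l.

Lemma N_eq k V : (k <= n)%nat -> regular l (U k) V ->
  N k = RInt (fun x => (ux (clamp l x) (node T n k) - V x) ^ 2) 0 l.
Proof.
  intros hk hV; apply regular_RInt_Derive; auto; apply z_regular; auto.
Qed.

Lemma N_pos k : (k <= n)%nat -> 0 <= N k.
Proof.
  intros hk; destruct (scheme_regular k hk) as [V hV].
  rewrite (N_eq k V) by auto; apply RInt_sqr_pos; auto.
  apply (z_regular k V hk hV).
Qed.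

Lemma D_eq k : D k
  = RInt (fun x => ((z (S k) (clamp l x) - z k (clamp l x)) / tau) ^ 2) 0 l.
Proof.
  apply RIntR_ext; auto; intros x hx; rewrite clamp_id; auto; unfold itv; lra.
Qed.

Lemma z_cts k : (k <= n)%nat -> cts (fun x => z k (clamp l x)).
Proof.
  intros hk; destruct (scheme_regular k hk) as [V hV].
  apply (z_regular k V hk hV).
Qed.

Lemma D_pos k : (k < n)%nat -> 0 <= D k.
Proof.
  intros hk; rewrite D_eq.
  assert (h1 := z_cts (S k) hk); assert (h2 := z_cts k ltac:(lia)).
  apply (RInt_sqr_pos (fun x => (z (S k) (clamp l x) - z k (clamp l x)) / tau));
    auto; cts_tac.
Qed.

Lemma N0_eq : N 0%nat = 0.
Proof.
  rewrite (N_eq 0%nat _ ltac:(lia) U0_regular), node_0.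
  rewrite (RIntR_ext _ (fun _ => 0) l); auto; [|intros; ring].
  rewrite RInt_const; unfold scal; simpl; unfold mult; simpl; ring.
Qed.

(** * Consistency, stability and convergence for a fixed step *)

Variable B : R.
Hypotheses (hB : 1 <= B)
  (bux : forall x t, itv l x -> itv T t -> Rabs (ux x t) <= B)
  (buxx : forall x t, itv l x -> itv T t -> Rabs (uxx x t) <= B)
  (bq : forall t, itv T t -> Rabs (qex t) <= B)
  (lq : forall t s, itv T t -> itv T s -> Rabs (qex t - qex s) <= B * Rabs (t - s))
  (bbeta : forall t, itv T t -> 0 <= beta t <= B)
  (d4u : forall x t h, itv l x -> 0 <= h -> 0 <= t - h -> t + h <= T ->
    Rabs (u x (t + h) - 2 * u x t + u x (t - h) - h ^ 2 * utt x t) <= B * h ^ 4)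
  (d2uxx : forall x t h, itv l x -> 0 <= h -> 0 <= t - h -> t + h <= T ->
    Rabs (uxx x (t + h) - 2 * uxx x t + uxx x (t - h)) <= B * h ^ 2)
  (tu : forall x h, itv l x -> itv T h ->
    Rabs (u x h - u x 0 - h * ut x 0 - h ^ 2 / 2 * utt x 0) <= B * h ^ 3)
  (tux : forall x h, itv l x -> itv T h ->
    Rabs (ux x h - ux x 0 - h * uxt x 0 - h ^ 2 / 2 * uxtt x 0) <= B * h ^ 2).

Let delta k := qex (node T n k) - q k.
(** With delta = beta (2 I - N), I^2 <= l B^2 N and N <= 1, one has (2 I - N)^2 <= 8 I^2 + 2 N^2 <=
    (8 l B^2 + 2) N. *)
Let P := B ^ 2 * (8 * l * B ^ 2 + 2).

Lemma P_pos : 0 <= P.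
Proof.
  assert (0 <= B ^ 2) by (apply pow_le; lra).
  apply Rmult_le_pos; auto.
  assert (0 <= 8 * l * B ^ 2) by (apply Rmult_le_pos; lra); lra.
Qed.

(* With e = z_k', the difference of the integrals is 2 <u_x, e> - |e|^2. *)
Lemma delta_sqr k : (k <= n)%nat -> N k <= 1 -> delta k ^ 2 <= P * N k.
Proof.
  intros hk hN1; destruct (scheme_regular k hk) as [V hV].
  assert (hN0 := N_pos k hk).
  assert (ht := node_itv k hk); set (t := node T n k) in *.
  assert (cV := proj1 (proj2 hV)).
  assert (cx := cont2_on_cts_x l T ux t hl' hT' hux_cont ht).
  assert (hS : RInt (fun y => ux y t ^ 2) 0 l
    = RInt (fun y => ux (clamp l y) t ^ 2) 0 l).
  { apply RIntR_ext; auto; intros x hx; rewrite clamp_id; auto; unfold itv; lra. }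
  set (I := RInt (fun x => ux (clamp l x) t * (ux (clamp l x) t - V x)) 0 l).
  assert (hd : delta k = beta t * (2 * I - N k)).
  { unfold delta, qex, q, kirchhoff, qcoef; fold t.
    rewrite (regular_RInt_Derive l (U k) V), (N_eq k V), hS by auto; fold t.
    assert (h : RInt (fun x => ux (clamp l x) t ^ 2 - V x ^ 2) 0 l
      = RInt (fun x => 2 * (ux (clamp l x) t * (ux (clamp l x) t - V x))
          - (ux (clamp l x) t - V x) ^ 2) 0 l)
      by (apply RIntR_ext; auto; intros; ring).
    rewrite !RIntR_minus, RIntR_scal in h by cts_tac.
    unfold I; rewrite <- h; ring. }
  assert (hI : I ^ 2 <= l * B ^ 2 * N k).
  { apply Rle_trans with (RInt (fun x => ux (clamp l x) t ^ 2) 0 l * N k).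
    - rewrite (N_eq k V) by auto; fold t.
      apply (RInt_Cauchy_Schwarz (fun x => ux (clamp l x) t)
        (fun x => ux (clamp l x) t - V x)); auto; cts_tac.
    - apply Rmult_le_compat_r; auto; apply RInt_le_const; auto; [cts_tac|].
      intros x hx; apply pow_maj_Rabs, bux; auto; apply clamp_itv; auto. }
  destruct (bbeta t ht) as [hb0 hb1].
  rewrite hd, Rpow_mult_distr; unfold P; rewrite Rmult_assoc.
  apply Rmult_le_compat; try apply pow2_ge_0; [apply pow_incr; auto|].
  assert (0 <= (2 * I + N k) ^ 2) by apply pow2_ge_0.
  assert (N k ^ 2 <= N k) by nra.
  nra.
Qed.

Lemma delta_small k : (k <= n)%nat -> tau <= 1 -> N k <= tau ^ 2 ->
  Rabs (delta k) <= (P + 1) * tau.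
Proof.
  intros hk ht1 hN; assert (hP := P_pos); assert (ht := step_pos).
  assert (hN1 : N k <= 1) by nra.
  assert (h := delta_sqr k hk hN1).
  (* Squares are compared, using P <= (P + 1)^2, which avoids the root of P. *)
  assert (h' : Rabs (delta k) <= Rabs ((P + 1) * tau)).
  { apply Rsqr_le_abs_0; rewrite !Rsqr_pow2, Rpow_mult_distr.
    apply Rle_trans with (1 := h), Rle_trans with (P * tau ^ 2).
    - apply Rmult_le_compat_l; auto.
    - apply Rmult_le_compat_r; [apply pow2_ge_0|nra]. }
  rewrite (Rabs_pos_eq ((P + 1) * tau)) in h' by (apply Rmult_le_pos; lra); auto.
Qed.

(** The energy identity, then Young's inequality, then a pointwise bound on the residual, whose
    integration gives the factor l. The factor tau comes from a - c = tau ((a - b) / tau + (b - c) /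
    tau). *)
Lemma step_estimate k : (S (S k) <= n)%nat ->
  D (S k) - D k + q (S k) / 2 * (N (S (S k)) - N k)
  <= tau * (l * (2 * ((B + B ^ 2) * tau ^ 2) ^ 2 + 2 * B ^ 2 * delta (S k) ^ 2)
            + (D (S k) + D k) / 2).
Proof.
  intros hk; assert (ht := step_pos).
  destruct (scheme_regular k ltac:(lia)) as [V0 h0].
  destruct (scheme_regular (S k) ltac:(lia)) as [V1 h1].
  destruct (scheme_step_regular k V0 V1 hk h0 h1)
    as [w' [w'' [cw' [cw'' [hw [h2 heq2]]]]]].
  assert (za := z_regular (S (S k)) _ hk h2).
  assert (zc := z_regular k _ ltac:(lia) h0).
  assert (cb := z_cts (S k) ltac:(lia)).
  rewrite (N_eq (S (S k)) _ hk h2), (N_eq k _ ltac:(lia) h0), !D_eq.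
  assert (n2 := node_itv (S (S k)) hk).
  assert (n1 := node_itv (S k) ltac:(lia)).
  assert (n0 := node_itv k ltac:(lia)).
  assert (hn1 : node T n (S k) = node T n k + tau) by apply node_S.
  assert (hn2 : node T n (S (S k)) = node T n (S k) + tau) by apply node_S.
  set (t2 := node T n (S (S k))) in *; set (t0 := node T n k) in *.
  set (t := node T n (S k)) in *.
  assert (ux2 := dx_on_antideriv l T ux uxx t2 hl' huxx n2).
  assert (ux0 := dx_on_antideriv l T ux uxx t0 hl' huxx n0).
  assert (cxx2 := cont2_on_cts_x l T uxx t2 hl' hT' huxx_cont n2).
  assert (cxx0 := cont2_on_cts_x l T uxx t0 hl' hT' huxx_cont n0).
  set (s'' := fun x => uxx (clamp l x) t2 + uxx (clamp l x) t0 - w'' x).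
  assert (hs : antideriv 0 l
    (fun x => ux (clamp l x) t2 + ux (clamp l x) t0 - w' x) s'').
  { apply (antideriv_minus 0 l
      (fun x => ux (clamp l x) t2 + ux (clamp l x) t0)
      (fun x => uxx (clamp l x) t2 + uxx (clamp l x) t0)); auto.
    apply (antideriv_plus 0 l (fun x => ux (clamp l x) t2)
      (fun x => uxx (clamp l x) t2)); auto. }
  assert (cs'' : cts s'') by (unfold s''; cts_tac).
  destruct za as [za [cza [za0 zal]]], zc as [zc [czc [zc0 zcl]]].
  assert (ca := proj1 za); assert (cc := proj1 zc); cbv beta in cza, czc.
  set (a := fun x => z (S (S k)) (clamp l x)) in *.
  set (b := fun x => z (S k) (clamp l x)) in *.
  set (c := fun x => z k (clamp l x)) in *.
  (* The residual is defined as the left side of the error equation, so the energy identity applies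
     at once; that it is small is shown from [hg] on. *)
  set (g := fun x => (a x - 2 * b x + c x) / tau ^ 2 - 1 / 2 * q (S k) * s'' x).
  assert (cg : cts g) by (unfold g; cts_tac).
  assert (a0 : a 0 = 0) by (unfold a; rewrite clamp_id; auto).
  assert (al : a l = 0) by (unfold a; rewrite clamp_id; auto).
  assert (c_0 : c 0 = 0) by (unfold c; rewrite clamp_id; auto).
  assert (c_l : c l = 0) by (unfold c; rewrite clamp_id; auto).
  eapply Rle_trans.
  { right; apply (energy_identity l tau (q (S k)) a _ b c _
      (fun x => ux (clamp l x) t2 + ux (clamp l x) t0 - w' x) s'' g
      hl ht za zc cb cza czc hs cs'' cg); auto.
    intros; ring. }
  assert (cd : cts (fun x => (a x - b x) / tau)) by cts_tac.
  assert (ce : cts (fun x => (b x - c x) / tau)) by cts_tac.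
  rewrite (RIntR_ext (fun x => g x * (a x - c x)) (fun x => tau * (g x *
    ((a x - b x) / tau + (b x - c x) / tau))) l)
    by (auto; intros; field; lra).
  rewrite RIntR_scal by cts_tac.
  apply Rmult_le_compat_l; [lra|].
  eapply Rle_trans;
    [apply (RInt_Young l g (fun x => (a x - b x) / tau)
      (fun x => (b x - c x) / tau)); auto|].
  apply Rplus_le_compat_r, RInt_le_const; auto; [cts_tac|].
  intros x hx; assert (ix : itv l x) by (unfold itv; lra).
  (* Three sources of error: the second difference in place of [utt], the mean of two levels in
     place of [uxx] at t, and the approximate coefficient in place of the exact one. *)
  assert (hg : g x = (u x t2 - 2 * u x t + u x t0 - tau ^ 2 * utt x t) / tau ^ 2
    - qex t / 2 * (uxx x t2 - 2 * uxx x t + uxx x t0)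
    + delta (S k) / 2 * (uxx x t2 + uxx x t0)).
  { unfold g, s'', a, b, c, z; rewrite !clamp_id by auto; fold t2 t t0.
    assert (e1 := heq2 x ix); fold t in e1.
    assert (e2 : utt x t - qex t * uxx x t = f x t).
    { unfold qex, kirchhoff; apply heq; auto; unfold itv in *; lra. }
    unfold delta; fold t.
    replace (uxx x t2) with (uxx x t2) by auto.
    transitivity ((u x t2 - 2 * u x t + u x t0) / tau ^ 2
      - 1 / 2 * q (S k) * (uxx x t2 + uxx x t0)
      - ((U (S (S k)) x - 2 * U (S k) x + U k x) / tau ^ 2
         - 1 / 2 * q (S k) * w'' x)).
    - field; lra.
    - rewrite e1, <- e2; field; lra. }
  assert (b1 : Rabs ((u x t2 - 2 * u x t + u x t0 - tau ^ 2 * utt x t) / tau ^ 2)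
    <= B * tau ^ 2).
  { assert (hd := d4u x t tau ix (Rlt_le _ _ ht)
      ltac:(unfold itv in *; lra) ltac:(unfold itv in *; lra)).
    replace (t + tau) with t2 in hd by auto.
    replace (t - tau) with t0 in hd by lra.
    assert (hp : 0 < / tau ^ 2) by (apply Rinv_0_lt_compat, pow_lt; auto).
    unfold Rdiv; rewrite Rabs_mult, (Rabs_pos_eq (/ tau ^ 2)) by lra.
    apply (Rmult_le_compat_r (/ tau ^ 2)) in hd; [|lra].
    replace (B * tau ^ 4 * / tau ^ 2) with (B * tau ^ 2) in hd by (field; lra).
    exact hd. }
  assert (b2 : Rabs (qex t / 2 * (uxx x t2 - 2 * uxx x t + uxx x t0))
    <= B ^ 2 * tau ^ 2).
  { assert (hd := d2uxx x t tau ix (Rlt_le _ _ ht)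
      ltac:(unfold itv in *; lra) ltac:(unfold itv in *; lra)).
    replace (t + tau) with t2 in hd by auto.
    replace (t - tau) with t0 in hd by lra.
    replace (B ^ 2 * tau ^ 2) with (B * (B * tau ^ 2)) by ring.
    rewrite Rabs_mult; apply Rmult_le_compat; try apply Rabs_pos; auto.
    unfold Rdiv; rewrite Rabs_mult, (Rabs_pos_eq (/ 2)) by lra.
    pose proof (bq t n1); pose proof (Rabs_pos (qex t)); lra. }
  assert (b3 : Rabs (delta (S k) / 2 * (uxx x t2 + uxx x t0))
    <= B * Rabs (delta (S k))).
  { unfold Rdiv; rewrite !Rabs_mult, (Rabs_pos_eq (/ 2)) by lra.
    assert (h : Rabs (uxx x t2 + uxx x t0) <= 2 * B).
    { apply Rle_trans with (1 := Rabs_triang _ _).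
      pose proof (buxx x t2 ix n2); pose proof (buxx x t0 ix n0); lra. }
    apply (Rmult_le_compat_l (Rabs (delta (S k)) * / 2)) in h; [lra|].
    apply Rmult_le_pos; [apply Rabs_pos|lra]. }
  assert (b4 : Rabs (g x) <= (B + B ^ 2) * tau ^ 2 + B * Rabs (delta (S k))).
  { rewrite hg; eapply Rle_trans; [apply Rabs_triang|].
    eapply Rle_trans; [apply Rplus_le_compat_r, Rabs_triang|].
    rewrite Rabs_Ropp; lra. }
  rewrite <- (pow2_abs (g x)), <- (pow2_abs (delta (S k))).
  eapply Rle_trans; [apply pow_incr; split; [apply Rabs_pos|exact b4]|].
  pose proof (pow2_ge_0 ((B + B ^ 2) * tau ^ 2 - B * Rabs (delta (S k)))).
  lra.
Qed.

Lemma N1_bound : N 1%nat <= l * (B * tau ^ 2) ^ 2.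
Proof.
  assert (h1 : (1 <= n)%nat) by lia; assert (i1 := node_itv 1 h1).
  assert (e1 : node T n 1 = tau) by (rewrite node_S, node_0; ring).
  assert (hr := z_regular 1 _ h1 U1_regular).
  rewrite (N_eq 1 _ h1 U1_regular); rewrite e1 in *.
  apply RInt_le_const; auto.
  - destruct hr as [_ [hr _]]; rewrite ?e1 in hr; cts_tac.
  - intros x hx; assert (ix : itv l x) by (unfold itv; lra).
    rewrite clamp_id by auto; apply pow_maj_Rabs.
    replace (ux x tau - (ux x 0 + tau * uxt x 0 + tau ^ 2 / 2 * uxtt x 0)) with
      (ux x tau - ux x 0 - tau * uxt x 0 - tau ^ 2 / 2 * uxtt x 0) by ring.
    apply tux; auto.
Qed.

Lemma D0_bound : D 0%nat <= l * (B * tau ^ 2) ^ 2.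
Proof.
  assert (ht := step_pos).
  assert (h1 : (1 <= n)%nat) by lia; assert (i1 := node_itv 1 h1).
  assert (e1 : node T n 1 = tau) by (rewrite node_S, node_0; ring).
  assert (c1' := z_cts 1 h1); assert (c0' := z_cts 0 ltac:(lia)).
  rewrite D_eq; apply RInt_le_const; auto; [cts_tac|].
  intros x hx; assert (ix : itv l x) by (unfold itv; lra).
  rewrite clamp_id by auto; apply pow_maj_Rabs; unfold z.
  rewrite e1 in *; rewrite U1_eq, (scheme_0 _ _ _ _ _ _ _ _ _ _ hU) by auto.
  rewrite <- hinit0, node_0 by auto.
  replace (u x tau - (u x 0 + tau * ut x 0 + tau ^ 2 / 2 * utt x 0)
    - (u x 0 - u x 0)) with
    (u x tau - u x 0 - tau * ut x 0 - tau ^ 2 / 2 * utt x 0) by ring.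
  unfold Rdiv at 1; rewrite Rabs_mult, (Rabs_pos_eq (/ tau))
    by (left; apply Rinv_0_lt_compat; auto).
  replace (B * tau ^ 2) with (B * tau ^ 3 * / tau) by (field; lra).
  apply Rmult_le_compat_r; [left; apply Rinv_0_lt_compat; auto|].
  apply tu; auto.
Qed.

(** The first two terms are the source and the coefficient of N in [step_estimate] after
    [delta_sqr]; the rest bounds the variation of q over one step. [K0] collects the initial energy,
    namely [D 0] and q 0 / 2 times [N 1], in units of tau^4. *)
Let C := 2 * l * (B + B ^ 2) ^ 2 + 2 * l * B ^ 2 * P + 2 * (P + 1) + B.
Let K0 := l * B ^ 2 + B / 2 * (l * B ^ 2).
Let M := (K0 + 1) * exp ((6 * (C / c0) + 2 * C + 2) * T).

Lemma convergence : tau <= 1 -> 2 * M / c0 * tau ^ 2 <= 1 ->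
  forall k, (k < n)%nat -> D k <= M * tau ^ 4 /\ N (S k) <= 2 * M / c0 * tau ^ 4.
Proof.
  intros ht1 hsm; assert (ht := step_pos); assert (hP := P_pos).
  assert (hB2 : 0 <= l * B ^ 2) by (apply Rmult_le_pos; [lra|apply pow_le; lra]).
  assert (hB3 : 0 <= B / 2 * (l * B ^ 2)) by (apply Rmult_le_pos; lra).
  assert (hB4 : 0 <= l * (B + B ^ 2) ^ 2)
    by (apply Rmult_le_pos; [lra|apply pow2_ge_0]).
  assert (hB5 : 0 <= l * B ^ 2 * P) by (apply Rmult_le_pos; lra).
  apply (energy_bootstrap n tau T C c0 K0 q D N); auto.
  - apply Req_le, (node_n).
  - unfold C; lra.
  - unfold K0; lra.
  - intros k hk; destruct (scheme_regular k ltac:(lia)) as [V hV].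
    apply (q_lower_bound k V); auto; lia.
  - apply N_pos.
  - apply D_pos.
  - apply N0_eq.
  - rewrite N0_eq, q0_eq.
    assert (hq0 := bq 0 i0); assert (h1 := N1_bound); assert (h2 := D0_bound).
    assert (h3 : qex 0 / 2 * (N 1%nat + 0) <= B / 2 * (l * (B * tau ^ 2) ^ 2)).
    { assert (hN1 := N_pos 1 ltac:(lia)).
      apply Rle_trans with (B / 2 * N 1%nat); [|apply Rmult_le_compat_l; lra].
      rewrite Rplus_0_r; apply Rmult_le_compat_r; auto.
      pose proof (RRle_abs (qex 0)); lra. }
    unfold K0; lra.
  - intros k hk hNk hNk1.
    assert (hN1 : N (S k) <= 1) by nra.
    split.
    (* The variation of q is that of the exact coefficient, at most B tau, corrected by two values
       of delta, at most (P + 1) tau each. *)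
    + assert (d1 := delta_small (S k) ltac:(lia) ht1 hNk1).
      assert (d0 := delta_small k ltac:(lia) ht1 hNk).
      assert (hlq := lq (node T n (S k)) (node T n k)
        (node_itv (S k) ltac:(lia)) (node_itv k ltac:(lia))).
      replace (Rabs (node T n (S k) - node T n k)) with tau in hlq.
      2: { rewrite node_S; replace (node T n k + tau - node T n k) with tau
             by ring; rewrite Rabs_pos_eq; lra. }
      apply Rle_trans with ((2 * (P + 1) + B) * tau).
      * unfold delta in d1, d0; revert d1 d0 hlq.
        unfold Rabs; repeat destruct Rcase_abs; lra.
      * apply Rmult_le_compat_r; [lra|]; unfold C; lra.
    + eexists; split; [|apply step_estimate; lia].
      assert (hd := delta_sqr (S k) ltac:(lia) hN1).
      assert (hN0 := N_pos (S k) ltac:(lia)).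
      assert (ht4 : 0 <= tau ^ 4) by (apply pow_le; lra).
      apply (Rmult_le_compat_l (2 * (l * B ^ 2))) in hd; [|lra].
      assert (h1 : 2 * l * (B + B ^ 2) ^ 2 * tau ^ 4 <= C * tau ^ 4)
        by (apply Rmult_le_compat_r; auto; unfold C; lra).
      assert (h2 : 2 * (l * B ^ 2) * P * N (S k) <= C * N (S k))
        by (apply Rmult_le_compat_r; auto; unfold C; lra).
      lra.
Qed.

End Scheme.

(** * Constants uniform in the step *)

Lemma convergence_rate : exists Tbar M5 M6 : R,
  0 < Tbar <= T /\ 0 < M5 /\ 0 < M6 /\
  forall (n : nat) (U : nat -> R -> R), (0 < n)%nat ->
    scheme l T alpha beta f psi0 ddpsi0 psi1 n U ->
    let tau := step T n in
    let m := Int_part (Tbar / tau) in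
    let z := fun (k : nat) (x : R) => u x (node T n k) - U k x in
    (forall k : nat, (1 <= Z.of_nat k <= m)%Z ->
       L2norm l (Derive (z k)) <= M5 * tau ^ 2) /\
    (forall k : nat, (0 <= Z.of_nat k <= m - 1)%Z ->
       L2norm l (fun x => (z (k + 1)%nat x - z k x) / tau) <= M6 * tau ^ 2).
Proof.
  destruct exact_bounds as [B [hB [b1 [b2 [b3 [b4 [b5 [b6 [b7 [b8 b9]]]]]]]]]].
  (* The constants of the closed section are restated, since the witnesses must be fixed before n
     and U appear. *)
  set (P := B ^ 2 * (8 * l * B ^ 2 + 2)).
  set (C := 2 * l * (B + B ^ 2) ^ 2 + 2 * l * B ^ 2 * P + 2 * (P + 1) + B).
  set (K0 := l * B ^ 2 + B / 2 * (l * B ^ 2)).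
  set (M := (K0 + 1) * exp ((6 * (C / c0) + 2 * C + 2) * T)).
  assert (hM : 0 < M).
  { apply Rmult_lt_0_compat; [|apply exp_pos].
    assert (0 <= l * B ^ 2) by (apply Rmult_le_pos; [lra|apply pow2_ge_0]).
    assert (0 <= B / 2 * (l * B ^ 2)) by (apply Rmult_le_pos; lra).
    unfold K0; lra. }
  assert (hMc : 0 < 2 * M / c0) by (apply Rdiv_lt_0_compat; lra).
  (* This gives both tau0 <= 1 and 2 M / c0 * tau0 <= 1; the smallness condition for tau <= tau0
     then follows from tau^2 <= tau0. *)
  set (tau0 := / (2 * M / c0 + 1)).
  assert (ht0 : 0 < tau0) by (apply Rinv_0_lt_compat; lra).
  assert (ht01 : tau0 <= 1 /\ 2 * M / c0 * tau0 <= 1).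
  { assert ((2 * M / c0 + 1) * tau0 = 1) by (apply Rinv_r; lra).
    assert (0 < 2 * M / c0 * tau0) by (apply Rmult_lt_0_compat; lra); lra. }
  destruct ht01 as [ht1 hMt].
  exists (Rmin T tau0), (sqrt (2 * M / c0)), (sqrt M).
  split; [split; [apply Rmin_glb_lt; lra|apply Rmin_l]|].
  split; [apply sqrt_lt_R0; lra|split; [apply sqrt_lt_R0; lra|]].
  intros n U hn hU tau m z.
  assert (ht := step_pos n hn); fold tau in ht.
  assert (hm : forall k, (Z.of_nat k <= m)%Z -> INR k * tau <= Rmin T tau0).
  { intros k hk; apply IZR_le in hk; rewrite <- INR_IZR_INZ in hk.
    destruct (base_Int_part (Rmin T tau0 / tau)) as [h _]; fold m in h.
    apply Rmult_le_reg_r with (/ tau); [apply Rinv_0_lt_compat; auto|].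
    replace (INR k * tau * / tau) with (INR k) by (field; lra).
    unfold Rdiv in h; lra. }
  pose proof (Rmin_l T tau0); pose proof (Rmin_r T tau0).
  assert (hkn : forall k, (Z.of_nat k <= m)%Z -> (k <= n)%nat).
  { intros k hk; apply INR_le, Rmult_le_reg_r with tau; auto.
    apply Rle_trans with T; [apply hm in hk; lra|].
    right; symmetry; apply (node_n n hn). }
  assert (conv : forall k, (Z.of_nat (S k) <= m)%Z ->
    RInt (fun x => ((z (S k) x - z k x) / tau) ^ 2) 0 l <= M * tau ^ 4 /\
    RInt (fun x => Derive (z (S k)) x ^ 2) 0 l <= 2 * M / c0 * tau ^ 4).
  { intros k hk.
    assert (h1 : tau <= tau0).
    (* An index k + 1 <= m forces m >= 1, hence tau <= [Tbar] <= tau0. *)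
    { assert (h := hm _ hk); rewrite S_INR in h; pose proof (pos_INR k).
      assert (0 <= INR k * tau) by (apply Rmult_le_pos; lra); lra. }
    apply (convergence n U hn hU B); auto; fold tau.
    - lra.
    - change (2 * M / c0 * tau ^ 2 <= 1).
      apply Rle_trans with (2 := hMt), Rmult_le_compat_l; nra. }
  assert (norm : forall X c, X <= c * tau ^ 4 -> 0 <= c ->
    sqrt X <= sqrt c * tau ^ 2).
  { intros X c hX hc.
    replace (tau ^ 2) with (sqrt (tau ^ 4)).
    - rewrite <- sqrt_mult_alt by auto; apply sqrt_le_1_alt, hX.
    - replace (tau ^ 4) with ((tau ^ 2) ^ 2) by ring.
      apply sqrt_pow2, pow2_ge_0. }
  unfold L2norm; split.
  - intros [|k] hk; [lia|].
    apply (norm _ (2 * M / c0)); [exact (proj2 (conv k ltac:(lia)))|lra].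
  - intros k hk; replace (k + 1)%nat with (S k) by lia.
    apply (norm _ M); [exact (proj1 (conv k ltac:(lia)))|lra].
Qed.

End Convergence.

Theorem theorem3p7
  (l T c0 c1 : R) (alpha beta : R -> R) (f : R -> R -> R)
  (psi0 dpsi0 ddpsi0 psi1 : R -> R)
  (u ux uxx ut utt uttt uxt uxtt uxxt : R -> R -> R)
  (hl : 0 < l) (hT : 0 < T)
  (halpha : C1_on T alpha) (hbeta : C1_on T beta)
  (hc0 : 0 < c0) (halpha_lb : forall t, itv T t -> c0 <= alpha t)
  (hc1 : 0 < c1) (hbeta_lb : forall t, itv T t -> c1 <= beta t)
  (hf : cont2_on l T f)
  (hwp : well_posed_with_solution l T alpha beta f psi0 psi1 u ux uxx ut utt)
  (* (a) *)
  (hpsi0' : deriv_on l psi0 dpsi0) (hpsi0'' : deriv_on l dpsi0 ddpsi0)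
  (hpsi0''_cont : continuous_on (itv l) ddpsi0)
  (hpsi0_0 : psi0 0 = 0) (hpsi0_l : psi0 l = 0)
  (hpsi1 : C1_on l psi1)
  (huxt : dt_on l T ux uxt) (huxtt : dt_on l T uxt uxtt)
  (huxtt_cont : cont2_on l T uxtt)
  (* (b) *)
  (huttt : dt_on l T utt uttt) (huttt_cont : cont2_on l T uttt)
  (huttt_lip : lipschitz_t l T uttt)
  (* (c) *)
  (huxxt : dt_on l T uxx uxxt) (huxxt_cont : cont2_on l T uxxt)
  (huxxt_lip : lipschitz_t l T uxxt) :
  exists Tbar M5 M6 : R,
    0 < Tbar <= T /\ 0 < M5 /\ 0 < M6 /\
    forall (n : nat) (U : nat -> R -> R), (0 < n)%nat ->
      scheme l T alpha beta f psi0 ddpsi0 psi1 n U ->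
      let tau := step T n in
      let m := Int_part (Tbar / tau) in
      let z := fun (k : nat) (x : R) => u x (node T n k) - U k x in
      (forall k : nat, (1 <= Z.of_nat k <= m)%Z ->
         L2norm l (Derive (z k)) <= M5 * tau ^ 2) /\
      (forall k : nat, (0 <= Z.of_nat k <= m - 1)%Z ->
         L2norm l (fun x => (z (k + 1)%nat x - z k x) / tau) <= M6 * tau ^ 2).
Proof.
  apply (convergence_rate l T c0 c1 alpha beta f psi0 dpsi0 ddpsi0 psi1
    u ux uxx ut utt uttt uxt uxtt uxxt); auto.
  apply hwp.
Qed.
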